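(* For every $n \geq 0$, there is a bijection $\rho$ between the set $\mathcal{M}_n$ of rooted planar maps with $n$ edges and the set $\mathcal{V}_n$ of v-trees with $n$ edges such that, for every $M \in \mathcal{M}_n$, the label of the root of $\rho(M)$ equals $\operatorname{outv}(M)$.
   Context: A rooted planar map is a planar map with a marked corner on the outer face; the empty map (single vertex) is the only map with $0$ edges. $\operatorname{outv}(M)$ is the number of vertices of $M$ incident to the outer face. A v-tree is a plane tree with integer node labels $\ell$ such that: (i) leaves have label $0$ or $1$; (ii) every non-root node $u$ with children $v_1,\ldots,v_k$ satisfies $0 \le \ell(u) \le 1+\sum_{i=1}^k \ell(v_i)$; (iii) the root $r$ with children $v_1,\ldots,v_k$ satisfies $\ell(r) = 1+\sum_{i=1}^k \ell(v_i)$. The size of a v-tree is its number of edges. *)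

(* Defs.v *)
From HB Require Import structures.
From mathcomp Require Import all_boot all_order all_algebra all_fingroup.
Set Implicit Arguments. Unset Strict Implicit. Unset Printing Implicit Defensive.
Import Order.TTheory GRing.Theory Num.Theory.

(* Rooted planar maps, combinatorially (rotation systems).                *)
(* A map with n edges has darts 'I_(2n); alpha is the edge involution     *)
(* (fixed-point free), sigma the vertex rotation.  Vertices = cycles of   *)
(* sigma, faces = cycles of phi := sigma o alpha  (in mathcomp,           *)
(* (alpha * sigma)%g applies alpha first).  The root corner is a dart r:  *)
(* the corner at the origin vertex of r; the outer face is the phi-cycle  *)
(* of r.  The empty map (n = 0) has no dart, root = None, one vertex.     *)

Record rmap (n : nat) := RMap {
  msigma : {perm 'I_(2 * n)};
  malpha : {perm 'I_(2 * n)};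
  mroot  : option 'I_(2 * n) }.

Definition mphi n (M : rmap n) : {perm 'I_(2 * n)} := (malpha M * msigma M)%g.

Definition mvertices n (M : rmap n) := porbits (msigma M).
Definition mfaces n (M : rmap n) := porbits (mphi M).

(* validity: alpha fixed-point-free involution, connectedness, genus 0
   (Euler: V - E + F = 2), and root present iff n > 0 *)
Definition is_rmap n (M : rmap n) : Prop :=
  [/\ forall d, malpha M d != d /\ malpha M (malpha M d) = d,
      forall d e, connect (fun x y => (y == msigma M x) || (y == malpha M x)) d e,
      n = 0%N \/ (#|mvertices M| + #|mfaces M| = n + 2)%N
    & (mroot M == None) = (n == 0%N)].

Definition rmap_iso n (M M' : rmap n) : Prop :=
  exists p : {perm 'I_(2 * n)},
    [/\ forall d, p (msigma M d) = msigma M' (p d),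
        forall d, p (malpha M d) = malpha M' (p d)
      & omap p (mroot M) = mroot M'].

Definition outv n (M : rmap n) : nat :=
  if mroot M is Some r then
    #|[set v in mvertices M | ~~ [disjoint v & porbit (mphi M) r]]|
  else 1%N.

Inductive vtree := VNode of int & seq vtree.

Definition vlabel (t : vtree) : int := let: VNode l _ := t in l.
Definition vchildren (t : vtree) : seq vtree := let: VNode _ cs := t in cs.

Fixpoint vsize (t : vtree) : nat :=
  let: VNode _ cs := t in sumn (map (fun c => (vsize c).+1) cs).

Definition child_sum (cs : seq vtree) : int := (\sum_(c <- cs) vlabel c)%R.

Fixpoint vt_ok (isroot : bool) (t : vtree) : bool :=
  let: VNode l cs := t in
  [&& (~~ nilp cs) || ((l == 0%R) || (l == 1%R)),
      (if isroot then l == (1 + child_sum cs)%R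
       else ((0 <= l)%R && (l <= 1 + child_sum cs)%R))
    & all (vt_ok false) cs].

Definition is_vtree (t : vtree) : Prop := vt_ok true t.

(* Main.v *)
(* Add a half-edge at the root corner, so that the empty map needs no special
   treatment and planarity reads V + E + F = #darts + 2.  Peel off the root edge
   e, say from the root vertex v to w: let y be the first return of the outer
   face to v after e, and cut v between e and y.  Afterwards e is a bridge, and
   deleting it leaves a map M' (the rest at v) and a map N (on the side of w).
   Conversely M is recovered from M', N and a number l between 0 and outv N:
   rooting N at the far end of e, the near end of e is either a new vertex
   (l = outv N) or is attached to N at the first visit of the (l + 1)-st vertex
   met along its outer face, and the vertices of N met before it remain visible,
   so outv M = outv M' + l.  This is the recursive structure of v-trees, with N
   the first subtree of the root and l its label.  That e becomes a bridge is
   the only place where planarity enters, through V + E + F <= #darts + 2c. *)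

Require Import Defs.
From mathcomp Require Import all_boot all_order all_algebra all_fingroup.
From Stdlib Require Import ClassicalEpsilon.
From mathcomp Require Import zify.
Set Implicit Arguments. Unset Strict Implicit. Unset Printing Implicit Defensive.
Local Open Scope nat_scope.

(** * Permutation orbits and the Euler inequality *)

(** A rotation system represents a map only up to relabelling, and gluing changes the type of darts,
    so everything is done up to isomorphism. The recursion [map_of] goes from trees to maps, and
    [rho] is its inverse. The delicate point is injectivity. Attaching at a first visit makes the
    time of the first return to the root vertex equal to the attachment time plus one; this time is
    invariant under isomorphism, and connectedness then recovers the two pieces. The half-edge is an
    orbit of size one of the edge involution: n edges give 2n + 1 darts and E = n + 1, so that V - n
    + F = 2 reads V + E + F = 2n + 3. *)

Definition stable (T : finType) (s : {perm T}) (S : {set T}) :=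
  forall x, x \in S -> s x \in S.

Lemma porbit_perm1 (T : finType) (s : {perm T}) x : porbit s (s x) = porbit s x.
Proof. by rewrite -[in s x](expg1 s) porbit_perm. Qed.

Lemma porbit_invariant (T : finType) (A : Type) (s : {perm T}) (f : T -> A) x y :
  (forall u, f (s u) = f u) -> y \in porbit s x -> f y = f x.
Proof.
move=> fs /porbitP[i ->]; elim: i => [|i IHi]; first by rewrite expg0 perm1.
by rewrite expgSr permM fs.
Qed.

Lemma stable_porbit (T : finType) (s : {perm T}) S x y :
  stable s S -> x \in S -> y \in porbit s x -> y \in S.
Proof.
move=> sS xS /porbitP[i ->]; elim: i => [|i IHi]; first by rewrite expg0 perm1.
by rewrite expgSr permM; apply: sS.
Qed.

Lemma stable_mem (T : finType) (s : {perm T}) S x :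
  stable s S -> (s x \in S) = (x \in S).
Proof.
move=> sS; apply/idP/idP => [sxS|]; last exact: sS.
by apply: (stable_porbit sS sxS); rewrite porbit_perm1 porbit_id.
Qed.

Lemma porbit_stable (T : finType) (s : {perm T}) x : stable s (porbit s x).
Proof.
by move=> y; rewrite -!eq_porbit_mem porbit_perm1.
Qed.

Lemma stableC (T : finType) (s : {perm T}) S : stable s S -> stable s (~: S).
Proof. by move=> sS x; rewrite !inE stable_mem. Qed.

Lemma stableI (T : finType) (s : {perm T}) S1 S2 :
  stable s S1 -> stable s S2 -> stable s (S1 :&: S2).
Proof. by move=> h1 h2 x; rewrite !inE => /andP[/h1-> /h2->]. Qed.

Lemma stableM (T : finType) (s t : {perm T}) S :
  stable s S -> stable t S -> stable (s * t) S.
Proof. by move=> hs ht x /hs/ht; rewrite permM. Qed.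

Lemma stable_tperm (T : finType) (x y : T) (S : {set T}) :
  (x \in S) = (y \in S) -> stable (tperm x y) S.
Proof. by move=> e u; case: tpermP => [->|->|]; rewrite ?e. Qed.

Lemma porbits_merge (T : finType) (s : {perm T}) x y :
  x \notin porbit s y -> #|porbits (tperm x y * s)|.+1 = #|porbits s|.
Proof.
move=> h; have := porbits_mul_tperm s x y; rewrite /= h.
by case: eqP h => [->|_ _]; [rewrite porbit_id | lia].
Qed.

Lemma porbits_split (T : finType) (s : {perm T}) x y :
  x != y -> x \in porbit s y -> #|porbits (tperm x y * s)| = #|porbits s|.+1.
Proof. by move=> xy h; have := porbits_mul_tperm s x y; rewrite /= h xy; lia. Qed.

(** By counting: the first product loses an orbit, and multiplying by the same transposition again
    restores it, so that the transposition now splits an orbit. *)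
Lemma porbit_tperm_merge (T : finType) (s : {perm T}) x y :
  x \notin porbit s y -> x \in porbit (tperm x y * s) y.
Proof.
move=> h; have := porbits_merge h; have := porbits_mul_tperm (tperm x y * s) x y.
by rewrite /= mulgA tperm2 mul1g; case: (x \in _) => //=; case: (x != y); lia.
Qed.

Lemma mul_tperm (T : finType) (s : {perm T}) x y :
  (s * tperm (s x) (s y) = tperm x y * s)%g.
Proof.
by apply/permP => u; rewrite !permM; case: (tpermP x y u) => [->|->|/eqP ux /eqP uy];
  rewrite ?tpermL ?tpermR // tpermD // (inj_eq perm_inj) eq_sym.
Qed.

(** Here [a] may be any permutation, not only an involution; the induction of [euler_le] on the
    points moved by [a] then stays within this class. *)
Definition euler (T : finType) (s a : {perm T}) :=
  #|porbits s| + #|porbits a| + #|porbits (a * s)|.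

(** Every component meets [R], so [#|R|] bounds the number of components. *)
Definition spanning (T : finType) (s a : {perm T}) (R : {set T}) :=
  forall S, stable s S -> stable a S -> R \subset S -> S = setT.

Lemma stable_tperm_mul (T : finType) (a : {perm T}) x (S : {set T}) :
  stable (tperm x (a x) * a) S -> (x \in S) = (a x \in S) -> stable a S.
Proof.
move=> h e; have -> : a = (tperm x (a x) * (tperm x (a x) * a))%g.
  by rewrite mulgA tperm2 mul1g.
by apply: stableM => //; apply: stable_tperm.
Qed.

Lemma porbits1 (T : finType) : #|porbits (1 : {perm T})| = #|T|.
Proof.
rewrite /porbits card_imset // => x y /eqP; rewrite eq_porbit_mem.
by case/porbitP=> i; rewrite expg1n perm1.
Qed.

Lemma spanning_or (T : finType) (s a : {perm T}) (R : {set T}) :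
  spanning s a R \/ exists S, [/\ stable s S, stable a S, R \subset S & S != setT].
Proof.
have [sp|] := boolP [forall S : {set T},
    [&& [forall y in S, s y \in S], [forall y in S, a y \in S] & R \subset S]
    ==> (S == setT)].
  left=> S sS aS RS; apply/eqP; move: (forallP sp S) => /implyP; apply.
  by apply/and3P; split => //; apply/forall_inP.
case/forallPn=> S; rewrite negb_imply => /andP[/and3P[/forall_inP sS /forall_inP aS RS] SnT].
by right; exists S; split.
Qed.

(* The Euler inequality V + E + F <= |T| + 2c.  Splitting an edge off raises E
   and changes F by one; when it disconnects the map it must lower the number of
   faces of the glued map, which pays for the extra component. *)
Lemma euler_le (T : finType) (s a : {perm T}) (R : {set T}) :
  spanning s a R -> euler s a <= #|T| + #|R|.*2.
Proof.
have [k] := ubnP #|[set x | a x != x]|; elim: k a R => // k IHk a R lek spR.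
(* Base case: for [a = 1] the faces are the vertices, E is the number of points, and every vertex
   contains a point of [R]. *)
have [a0|[x]] := set_0Vmem [set x | a x != x].
  have a1 : a = 1%g.
    by apply/permP => x; rewrite perm1; apply/eqP; apply: contraFT (in_set0 x); rewrite -a0 inE.
  subst a.
  have sub : porbits s \subset porbit s @: R.
    apply/subsetP => _ /imsetP[x _ ->].
    suff: x \in \bigcup_(y in R) porbit s y.
      by case/bigcupP=> y yR; rewrite -eq_porbit_mem => /eqP->; apply: imset_f.
    rewrite (spR (\bigcup_(y in R) porbit s y)) ?inE // => [y|y|].
    - by case/bigcupP=> u uR yu; apply/bigcupP; exists u => //; apply: porbit_stable.
    - by rewrite perm1.
    - by apply/subsetP=> y yR; apply/bigcupP; exists y => //; apply: porbit_id.
  have := leq_trans (subset_leq_card sub) (leq_imset_card _ _).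
  by rewrite /euler mul1g porbits1; lia.
rewrite inE => ax.
(* [a'] cuts [a x] out of its cycle and makes it a fixed point. *)
set a' := (tperm x (a x) * a)%g.
have a'E u : u != x -> u != a x -> a' u = a u.
  by move=> ux uax; rewrite permM tpermD // eq_sym.
have lek' : #|[set y | a' y != y]| < k.
  have: [set y | a' y != y] \proper [set y | a y != y].
    apply/properP; split; last first.
      by exists (a x); rewrite !inE ?permM ?tpermR ?eqxx // (inj_eq perm_inj).
    apply/subsetP=> y; rewrite !inE; have [->//|yx] := eqVneq y x.
    have [->|yax] := eqVneq y (a x); first by rewrite permM tpermR eqxx.
    by rewrite a'E.
  by move/proper_card; move: lek; rewrite ltnS => h1 h2; apply: leq_trans h2 h1.
have E' : #|porbits a'| = #|porbits a|.+1.
  by apply: porbits_split; rewrite 1?eq_sym // porbit_perm1 porbit_id.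
have F' : (a' * s = tperm x (a x) * (a * s))%g by rewrite mulgA.
have [/(IHk _ _ lek')|[S [sS aS RS SnT]]] := spanning_or s a' R.
  rewrite /euler E' F'; have := porbits_mul_tperm (a * s) x (a x).
  by rewrite /= eq_sym ax; case: (x \notin _) => /=; lia.
(* A set [S] not separating [x] from [a x] would be stable under [a] too, hence everything. *)
have xor : (x \in S) != (a x \in S).
  apply: contraNneq SnT => e; apply/eqP/spR => //.
  exact: stable_tperm_mul e.
have [u [v [uS vS uv]]] : exists u v,
    [/\ u \notin S, v \in S & (u, v) = (x, a x) \/ (u, v) = (a x, x)].
  case xS: (x \in S) xor => /=; case axS: (a x \in S) => // _.
    by exists (a x), x; rewrite axS xS; split => //; right.
  by exists x, (a x); rewrite axS xS; split => //; left.
(* One more representative is enough: if a stable [S2] contains [u] but not [v], then [S :&: S2]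
   contains neither, so it is stable under [a], contains [R], and must be everything, although [S]
   is not. *)
have spR' : spanning s a' (u |: R).
  move=> S2 sS2 aS2; rewrite subUset sub1set => /andP[uS2 RS2].
  have [e|vS2] := boolP (v \in S2).
    apply: spR => //; apply: (@stable_tperm_mul _ a x) => //.
    by case: uv => -[<- <-]; rewrite e uS2.
  case/eqP: SnT; apply/setP => y; rewrite in_setT.
  suff /setP/(_ y) : S :&: S2 = setT by rewrite !inE => /andP[].
  apply: spR; [exact: stableI| |by rewrite subsetI RS].
  apply: (@stable_tperm_mul _ a x); first exact: stableI.
  by rewrite !inE; case: uv => -[<- <-]; rewrite (negPf uS) (negPf vS2) andbF.
(* Each face of [a' * s] lies inside [S] or outside it, so the two ends are on different faces,
   which [a] joins. *)
have merge : x \notin porbit (a' * s) (a x).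
  apply/negP => h; case/negP: xor; apply/eqP.
  have st : stable (a' * s) S by apply: stableM.
  apply/idP/idP => hS; last exact: stable_porbit st hS h.
  by apply: stable_porbit st hS _; rewrite porbit_sym.
have F2 : (a * s = tperm x (a x) * (a' * s))%g by rewrite F' mulgA tperm2 mul1g.
have := IHk _ _ lek' spR'; rewrite /euler E'.
have := porbits_merge merge; rewrite -F2.
have := cardsU1 u R; have : (u \notin R) <= 1 by case: (_ \notin _).
by lia.
Qed.

Lemma imset_porbit (T U : finType) (s : {perm T}) (t : {perm U}) (f : T -> U) x :
  (forall u, f (s u) = t (f u)) -> f @: porbit s x = porbit t (f x).
Proof.
move=> fs; have fX i u : f ((s ^+ i)%g u) = (t ^+ i)%g (f u).
  elim: i => [|i IHi]; first by rewrite !expg0 !perm1.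
  by rewrite !expgSr !permM fs IHi.
apply/setP=> v; apply/imsetP/porbitP => [[_ /porbitP[i ->] ->]|[i ->]].
  by exists i; rewrite fX.
by exists ((s ^+ i)%g x); rewrite ?fX ?mem_porbit.
Qed.

Lemma mem_imset_porbit (T U : finType) (s : {perm T}) (t : {perm U}) (f : T -> U) x y :
  injective f -> (forall u, f (s u) = t (f u)) ->
  (f y \in porbit t (f x)) = (y \in porbit s x).
Proof. by move=> fI fs; rewrite -(imset_porbit _ fs) mem_imset. Qed.

Lemma porbits_bij (T U : finType) (s : {perm T}) (t : {perm U}) (f : T -> U) :
  bijective f -> (forall u, f (s u) = t (f u)) -> #|porbits t| = #|porbits s|.
Proof.
move=> fB fs; have fI := bij_inj fB.
rewrite -(card_imset (mem (porbits s)) (imset_inj fI)); congr #|pred_of_set _|.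
rewrite /porbits -imset_comp; apply/setP => S; case: fB => g fK gK.
apply/imsetP/imsetP => [[x _ ->]|[x _ ->]]; last by exists (f x); rewrite //= (imset_porbit _ fs).
by exists (g x); rewrite //= (imset_porbit _ fs) gK.
Qed.

Lemma porbits_cover (A B T : finType) (s : {perm A}) (t : {perm B}) (w : {perm T})
    (f : A -> T) (g : B -> T) :
  injective f -> injective g -> (forall x, f (s x) = w (f x)) ->
  (forall y, g (t y) = w (g y)) -> (forall x y, f x <> g y) ->
  (forall u, (exists x, u = f x) \/ (exists y, u = g y)) ->
  #|porbits w| = #|porbits s| + #|porbits t|.
Proof.
move=> fI gI fs gt fg cov.
have -> : porbits w = (fun S : {set A} => f @: S) @: porbits s
    :|: (fun S : {set B} => g @: S) @: porbits t.
  apply/setP => S; rewrite inE; apply/imsetP/orP => [[u _ ->]|].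
    case: (cov u) => [[x ->]|[y ->]]; [left|right]; apply/imsetP.
      by exists (porbit s x); rewrite ?imset_f // (imset_porbit _ fs).
    by exists (porbit t y); rewrite ?imset_f // (imset_porbit _ gt).
  case=> /imsetP[_ /imsetP[x _ ->] ->]; first by exists (f x); rewrite ?(imset_porbit _ fs).
  by exists (g x); rewrite ?(imset_porbit _ gt).
rewrite cardsU (card_imset _ (imset_inj fI)) (card_imset _ (imset_inj gI)).
rewrite (_ : _ :&: _ = set0) ?cards0 ?subn0 //.
apply/eqP/set0Pn => -[_ /setIP[/imsetP[_ /imsetP[x _ ->] ->] /imsetP[_ /imsetP[y _ ->] e]]].
have : f x \in f @: porbit s x by rewrite imset_f ?porbit_id.
by rewrite e => /imsetP[v _ /fg].
Qed.

Definition lift_opt_fun (A : finType) (s : {perm A}) (u : option A) := omap s u.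
Lemma lift_opt_inj (A : finType) (s : {perm A}) : injective (lift_opt_fun s).
Proof. by case=> [x|] [y|] //= [/perm_inj->]. Qed.
Definition lift_opt (A : finType) (s : {perm A}) := perm (@lift_opt_inj A s).

Definition sum_perm_fun (A B : finType) (s : {perm A}) (t : {perm B}) (u : A + B) :=
  match u with inl x => inl (s x) | inr y => inr (t y) end.
Lemma sum_perm_inj (A B : finType) (s : {perm A}) (t : {perm B}) : injective (sum_perm_fun s t).
Proof. by case=> [x|x] [y|y] //= [/perm_inj->]. Qed.
Definition sum_perm (A B : finType) (s : {perm A}) (t : {perm B}) := perm (@sum_perm_inj A B s t).

Lemma lift_optE (A : finType) (s : {perm A}) u : lift_opt s u = omap s u.
Proof. by rewrite permE. Qed.

Lemma sum_permE (A B : finType) (s : {perm A}) (t : {perm B}) u :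
  sum_perm s t u = match u with inl x => inl (s x) | inr y => inr (t y) end.
Proof. by rewrite permE. Qed.

Lemma lift_optM (A : finType) (s t : {perm A}) :
  (lift_opt s * lift_opt t)%g = lift_opt (s * t)%g.
Proof. by apply/permP => -[x|]; rewrite !(permM, lift_optE) //= permM. Qed.

Lemma sum_permM (A B : finType) (s s' : {perm A}) (t t' : {perm B}) :
  (sum_perm s t * sum_perm s' t')%g = sum_perm (s * s') (t * t').
Proof. by apply/permP => -[x|x]; rewrite !(permM, sum_permE). Qed.

Lemma porbits_lift_opt (A : finType) (s : {perm A}) : #|porbits (lift_opt s)| = #|porbits s|.+1.
Proof.
rewrite (@porbits_cover _ unit _ s 1 _ Some (fun=> None)) ?porbits1 ?card_unit ?addn1 //.
- by move=> x y [].
- by case; case.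
- by move=> x; rewrite lift_optE.
- by move=> x; rewrite lift_optE.
- by case=> [x|]; [left; exists x | right; exists tt].
Qed.

Lemma porbits_sum_perm (A B : finType) (s : {perm A}) (t : {perm B}) :
  #|porbits (sum_perm s t)| = #|porbits s| + #|porbits t|.
Proof.
apply: (porbits_cover (f := inl) (g := inr)) => //.
- by move=> x y [].
- by move=> x y [].
- by move=> x; rewrite sum_permE.
- by move=> x; rewrite sum_permE.
- by case=> x; [left | right]; exists x.
Qed.

(** * Maps with a root half-edge *)

(* hroot is the extra half-edge: it carries the root corner and is the unique
   fixed point of ha. *)
Record hmap := HMap { dart : finType; hs : {perm dart}; ha : {perm dart}; hroot : dart }.
Definition hphi M := (ha M * hs M)%g.

Definition halfrooted M :=
  (forall x, ha M (ha M x) = x) /\ (forall x, (ha M x == x) = (x == hroot M)).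

Definition valid M :=
  [/\ halfrooted M, spanning (hs M) (ha M) [set hroot M]
    & euler (hs M) (ha M) = #|dart M| + 2].

Definition morph M N (p : dart M -> dart N) :=
  [/\ forall x, p (hs M x) = hs N (p x), forall x, p (ha M x) = ha N (p x)
    & p (hroot M) = hroot N].

Definition iso M N := exists2 p : dart M -> dart N, bijective p & morph p.

Lemma iso_sym M N : iso M N -> iso N M.
Proof.
case=> p [q pK qK] [ps pa pr]; exists q; first by exists p.
by split=> [x|x|]; apply: (can_inj pK); rewrite ?ps ?pa ?pr !qK.
Qed.

Lemma iso_trans M N P : iso M N -> iso N P -> iso M P.
Proof.
case=> p pB [ps pa pr] [q qB [qs qa qr]]; exists (q \o p); first exact: bij_comp.
by split=> [x|x|] /=; rewrite ?ps ?pa ?pr.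
Qed.

Lemma hroot_fixed M : halfrooted M -> ha M (hroot M) = hroot M.
Proof. by case=> _ h; apply/eqP; rewrite h. Qed.

Lemma ha_fixed M x : halfrooted M -> ha M x = x -> x = hroot M.
Proof. by case=> _ h /eqP; rewrite h => /eqP. Qed.

Lemma hphiE M x : hphi M x = hs M (ha M x).
Proof. by rewrite permM. Qed.

Lemma morph_phi M N (p : dart M -> dart N) x : morph p -> p (hphi M x) = hphi N (p x).
Proof. by case=> ps pa _; rewrite !hphiE ps pa. Qed.

(** The image of a morphism is stable and contains the root half-edge. *)
Lemma morph_surj M N (p : dart M -> dart N) u :
  spanning (hs N) (ha N) [set hroot N] -> morph p -> exists x, p x = u.
Proof.
move=> sp [ps pa pr].
have: u \in p @: setT.
  rewrite (sp (p @: setT)) ?inE // => [_ /imsetP[x _ ->]|_ /imsetP[x _ ->]|].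
  - by rewrite -ps imset_f ?inE.
  - by rewrite -pa imset_f ?inE.
  - by rewrite sub1set -pr imset_f ?inE.
by case/imsetP=> x _ ->; exists x.
Qed.

Lemma inj_morph_bij M N (p : dart M -> dart N) :
  spanning (hs N) (ha N) [set hroot N] -> morph p -> injective p -> bijective p.
Proof.
move=> sp pm pI; apply: inj_card_bij => //.
rewrite -(card_codom pI); apply: subset_leq_card; apply/subsetP => u _.
by have [x <-] := morph_surj u sp pm; apply: codom_f.
Qed.

Lemma iso_halfrooted M N : iso M N -> halfrooted M -> halfrooted N.
Proof.
case=> p [q pK qK] [ps pa pr] [h1 h2]; split=> u; rewrite -[u]qK -!pa.
  by rewrite h1.
by rewrite -pr !(inj_eq (can_inj pK)) h2.
Qed.

Lemma iso_spanning M N : iso M N ->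
  spanning (hs M) (ha M) [set hroot M] -> spanning (hs N) (ha N) [set hroot N].
Proof.
case=> p [q pK qK] [ps pa pr] sp S sS aS; rewrite sub1set => rS.
apply/setP => u; rewrite inE -[u]qK.
have /setP/(_ (q u)) : p @^-1: S = setT.
  apply: sp => [x|x|]; rewrite ?sub1set !inE.
  - by rewrite ps => /sS.
  - by rewrite pa => /aS.
  - by rewrite pr.
by rewrite !inE.
Qed.

Lemma iso_euler M N : iso M N -> euler (hs M) (ha M) = euler (hs N) (ha N).
Proof.
case=> p pB pm; have [ps pa pr] := pm.
rewrite /euler (porbits_bij pB ps) (porbits_bij pB pa).
by rewrite (@porbits_bij _ _ (ha M * hs M) (ha N * hs N) _ pB) // => x; apply: (morph_phi x pm).
Qed.

Lemma iso_card M N : iso M N -> #|dart M| = #|dart N|.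
Proof. by case=> p pB _; apply: bij_eq_card pB. Qed.

Lemma iso_valid M N : iso M N -> valid M -> valid N.
Proof.
move=> i [h sp e]; split; [exact: iso_halfrooted i h|exact: iso_spanning i sp|].
by rewrite -(iso_euler i) -(iso_card i).
Qed.

(** * First occurrences in a sequence *)

Definition firsts (A : eqType) (x0 : A) (os : seq A) :=
  [seq i <- iota 0 (size os) | index (nth x0 os i) os == i].

Lemma firstP (A : eqType) (x0 : A) (os : seq A) i : i < size os ->
  (index (nth x0 os i) os == i) = (nth x0 os i \notin take i os).
Proof.
move=> lti; rewrite (in_take_leq _ (ltnW lti)) -leqNgt.
by apply/eqP/idP => [->//|h]; apply/eqP; rewrite eqn_leq h index_nth.
Qed.

Lemma firsts_rcons (A : eqType) (x0 : A) (os : seq A) x :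
  firsts x0 (rcons os x) = firsts x0 os ++ (if x \in os then [::] else [:: size os]).
Proof.
rewrite /firsts size_rcons -addn1 iotaD filter_cat /= add0n; congr (_ ++ _).
  apply: eq_in_filter => i; rewrite mem_iota add0n /= => lti.
  by rewrite nth_rcons lti -cats1 index_cat mem_nth.
rewrite nth_rcons ltnn eqxx -cats1 index_cat /= eqxx addn0.
case xos: (x \in os); last by rewrite eqxx.
by rewrite ltn_eqF // index_mem.
Qed.

Lemma size_undup_rcons (A : eqType) (os : seq A) x :
  size (undup (rcons os x)) = size (undup os) + (x \notin os).
Proof.
have /perm_size-> : perm_eq (undup (rcons os x)) (undup (x :: os)).
  by apply: uniq_perm; rewrite ?undup_uniq // => y; rewrite !mem_undup mem_rcons.
by rewrite /=; case: (x \in os); rewrite ?addn0 ?addn1.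
Qed.

Lemma size_firsts (A : eqType) (x0 : A) (os : seq A) : size (firsts x0 os) = size (undup os).
Proof.
elim/last_ind: os => // os x IHos.
by rewrite firsts_rcons size_cat IHos size_undup_rcons; case: (x \in os).
Qed.

(** Together with [firsts_nth], a bijection between the positions of first occurrences and the ranks
    below the number of distinct values. *)
Lemma nth_firsts (A : eqType) (x0 : A) (os : seq A) j : j < size os ->
  nth x0 os j \notin take j os ->
  size (undup (take j os)) < size (undup os) /\
  nth (size os) (firsts x0 os) (size (undup (take j os))) = j.
Proof.
(* The default [size os] would change along the induction, so it is replaced by the fixed value
   [j]. *)
move=> ltj nj; suff [h1 h2] : size (undup (take j os)) < size (undup os) /\
    nth j (firsts x0 os) (size (undup (take j os))) = j.
  by split=> //; rewrite (set_nth_default j) ?size_firsts.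
elim/last_ind: os ltj nj => // os x IHos.
rewrite size_rcons ltnS leq_eqVlt => /orP[/eqP->|ltj].
  rewrite -cats1 take_size_cat // nth_cat ltnn subnn /= => xos.
  rewrite cats1 size_undup_rcons xos addn1 firsts_rcons (negPf xos); split=> //.
  by rewrite nth_cat size_firsts ltnn subnn.
rewrite -cats1 (takel_cat _ (ltnW ltj)) nth_cat ltj cats1 => nj.
have [h1 h2] := IHos ltj nj.
rewrite size_undup_rcons firsts_rcons; split; first by rewrite ltn_addr.
by rewrite nth_cat size_firsts h1.
Qed.

Lemma firsts_nth (A : eqType) (x0 : A) (os : seq A) l : l < size (undup os) ->
  let j := nth (size os) (firsts x0 os) l in
  [/\ j < size os, nth x0 os j \notin take j os & size (undup (take j os)) = l].
Proof.
move=> ltl j; have : j \in firsts x0 os by rewrite mem_nth ?size_firsts.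
rewrite mem_filter mem_iota add0n /= => /andP[fj ltj].
rewrite firstP // in fj; split=> //; have [h1 h2] := nth_firsts ltj fj.
apply/eqP; rewrite -(@nth_uniq _ (size os) (firsts x0 os)) ?size_firsts ?h2 //.
by rewrite filter_uniq ?iota_uniq.
Qed.

Lemma firsts_map (A B : eqType) (x0 : A) (y0 : B) (h : A -> B) (os : seq A) :
  injective h -> firsts y0 (map h os) = firsts x0 os.
Proof.
move=> hI; rewrite /firsts size_map; apply: eq_in_filter => i.
by rewrite mem_iota add0n /= => lti; rewrite (nth_map x0) // index_map.
Qed.

Lemma map_traject (A B : Type) (f : A -> A) (g : B -> B) (p : A -> B) x n :
  (forall u, p (f u) = g (p u)) -> map p (traject f x n) = traject g (p x) n.
Proof. by move=> fg; elim: n x => //= n IHn x; rewrite IHn fg. Qed.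

Lemma size_undup_map (A : finType) (B : finType) (K : A -> B) (w : seq A) :
  size (undup (map K w)) = #|K @: [set x in w]|.
Proof.
rewrite -(card_uniqP (undup_uniq _)); apply: eq_card => y.
rewrite mem_undup; apply/mapP/imsetP => -[x].
  by move=> xw ->; exists x; rewrite ?inE.
by rewrite inE => xw ->; exists x.
Qed.

(* The outer face read from the root half-edge, which comes last. *)
Definition walk M := traject (hphi M) (hphi M (hroot M)) #|porbit (hphi M) (hroot M)|.
Definition step M i := iter i (hphi M) (hphi M (hroot M)).
Definition verts M := map (porbit (hs M)) (walk M).
Definition outer M := size (undup (verts M)).
(* The time of the first visit of the vertex number l.  The default size (walk M),
   reached for l >= outer M, stands for a new vertex: corner returns None there. *)
Definition visit M l := nth (size (walk M)) (firsts set0 (verts M)) l.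
Definition corner M j :=
  if j < size (walk M) then Some ((hs M)^-1%g (step M j)) else None.

Lemma size_walk M : size (walk M) = #|porbit (hphi M) (hroot M)|.
Proof. exact: size_traject. Qed.

Lemma size_verts M : size (verts M) = size (walk M).
Proof. exact: size_map. Qed.

Lemma nth_verts M j : j < size (walk M) ->
  nth set0 (verts M) j = porbit (hs M) (step M j).
Proof.
move=> h; rewrite (nth_map (hphi M (hroot M))) //.
by rewrite /walk nth_traject // -size_walk.
Qed.

Lemma mem_walk M x : (x \in walk M) = (x \in porbit (hphi M) (hroot M)).
Proof. by rewrite -porbit_perm1 porbit_traject porbit_perm1. Qed.

Lemma outerE M : outer M = #|porbit (hs M) @: porbit (hphi M) (hroot M)|.
Proof.
rewrite /outer size_undup_map.
suff -> : [set x in walk M] = porbit (hphi M) (hroot M) by [].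
by apply/setP=> x; rewrite inE mem_walk.
Qed.

Lemma iso_walk M N (p : dart M -> dart N) : bijective p -> morph p -> walk N = map p (walk M).
Proof.
move=> pB pm; have [_ _ pr] := pm; have pI := bij_inj pB.
rewrite /walk (map_traject _ _ (fun x => morph_phi x pm)) (morph_phi _ pm) pr.
congr traject; rewrite -pr -(imset_porbit _ (fun x => morph_phi x pm)).
by rewrite card_imset.
Qed.

Lemma iso_verts M N (p : dart M -> dart N) : bijective p -> morph p ->
  verts N = map (fun S : {set dart M} => p @: S) (verts M).
Proof.
move=> pB pm; have [ps _ _] := pm; rewrite /verts (iso_walk pB pm) -!map_comp.
by apply: eq_map => x /=; rewrite (imset_porbit _ ps).
Qed.

Lemma iso_outer M N : iso M N -> outer M = outer N.
Proof.
case=> p pB pm; have pI := bij_inj pB.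
by rewrite /outer (iso_verts pB pm) (undup_map_inj (imset_inj pI)) size_map.
Qed.

Lemma iso_visit M N l : iso M N -> visit M l = visit N l.
Proof.
case=> p pB pm; have pI := bij_inj pB.
rewrite /visit (iso_verts pB pm) (firsts_map set0 _ _ (imset_inj pI)).
by rewrite (iso_walk pB pm) size_map.
Qed.

Lemma iso_corner M N (p : dart M -> dart N) j : bijective p -> morph p ->
  corner N j = omap p (corner M j).
Proof.
move=> pB pm; rewrite /corner (iso_walk pB pm) size_map; case: ifP => //= _.
have [ps _ pr] := pm; congr Some; apply: (@perm_inj _ (hs N)).
rewrite -ps !permKV /step -pr -(morph_phi _ pm).
by elim: j => //= j ->; rewrite (morph_phi _ pm).
Qed.

(** The label read back from an attachment time: inverse to [visit] on admissible times. *)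
Definition seen M j := size (undup (take j (verts M))).
(** The range of [visit]. Because only first visits are allowed, the outer walk of the glued map
    stays away from the root vertex until the attachment corner is passed. *)
Definition admissible M j := j <= size (walk M) /\
  (j < size (walk M) -> forall i, i < j -> step M i \notin porbit (hs M) (step M j)).

Lemma stepS M i : step M i.+1 = hphi M (step M i).
Proof. by []. Qed.

Lemma size_walk_gt0 M : 0 < size (walk M).
Proof. by rewrite size_walk lt0n card_porbit_neq0. Qed.

Lemma step_last M : step M (size (walk M)).-1 = hroot M.
Proof.
rewrite /step -iterSr prednK ?size_walk_gt0 // size_walk; exact: iter_porbit.
Qed.

Lemma step_mem M i : step M i \in porbit (hphi M) (hroot M).
Proof.
rewrite /step -iterSr -(permX (hphi M)); exact: mem_porbit.
Qed.

Lemma step_inj M i j : i < size (walk M) -> j < size (walk M) -> step M i = step M j -> i = j.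
Proof.
move=> hi hj e; apply/eqP; rewrite -(@nth_uniq _ (hphi M (hroot M)) (walk M)) //.
  by rewrite /walk !nth_traject -?size_walk //; apply/eqP.
by rewrite /walk -porbit_perm1 uniq_traject_porbit.
Qed.

Lemma step_nroot M i j : i.+1 < j -> j <= size (walk M) -> step M i <> hroot M.
Proof.
move=> ij jd; rewrite -step_last => /step_inj-/(_ _ _)/eqP.
by have := size_walk_gt0 M; lia.
Qed.

Lemma take_verts M j : j <= size (walk M) ->
  take j (verts M) = [seq porbit (hs M) (step M i) | i <- iota 0 j].
Proof.
move=> h; apply: (@eq_from_nth _ set0) => [|i].
  by rewrite size_takel ?size_verts // size_map size_iota.
rewrite size_takel ?size_verts // => ij.
rewrite nth_take // (nth_map 0) ?size_iota // nth_iota // add0n.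
exact: nth_verts (leq_trans ij h).
Qed.

Lemma first_visitP M j : j < size (walk M) ->
  reflect (forall i, i < j -> step M i \notin porbit (hs M) (step M j))
          (nth set0 (verts M) j \notin take j (verts M)).
Proof.
move=> jd; rewrite nth_verts // (take_verts (ltnW jd)).
apply: (iffP idP) => [h i ij|h].
  apply: contra h; rewrite -eq_porbit_mem => /eqP<-; apply: map_f.
  by rewrite mem_iota.
apply/mapP=> -[i]; rewrite mem_iota add0n /= => ij e.
by have := h i ij; rewrite -eq_porbit_mem e eqxx.
Qed.

Lemma visit_admissible M l : admissible M (visit M l).
Proof.
have [lt|ge] := ltnP l (outer M).
  have [] := firsts_nth set0 lt; rewrite size_verts -/(visit M l) => h1 h2 _.
  by split; [exact: ltnW | move=> _; apply/first_visitP].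
by rewrite /visit nth_default ?size_firsts //; split; rewrite ?ltnn.
Qed.

Lemma seen_visit M l : l <= outer M -> seen M (visit M l) = l.
Proof.
rewrite leq_eqVlt => /orP[/eqP->|lt].
  by rewrite /visit nth_default ?size_firsts // /seen -size_verts take_size.
by have [] := firsts_nth set0 lt; rewrite size_verts.
Qed.

Lemma visit_seen M j : admissible M j -> visit M (seen M j) = j.
Proof.
case; rewrite leq_eqVlt => /orP[/eqP->|jd] h.
  by rewrite /seen -size_verts take_size /visit nth_default ?size_firsts // size_verts.
have := @nth_firsts _ set0 (verts M) j; rewrite size_verts => /(_ jd)[] //.
by apply/first_visitP => // i; apply: h.
Qed.

Lemma seen_le M j : admissible M j -> seen M j <= outer M.
Proof.
case; rewrite leq_eqVlt => /orP[/eqP->|jd] h.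
  by rewrite /seen -size_verts take_size.
have := @nth_firsts _ set0 (verts M) j; rewrite size_verts => /(_ jd)[] //.
  by apply/first_visitP => // i; apply: h.
by move=> /ltnW.
Qed.

(** * Gluing along a new root edge *)

Section Glue.
Variables (M N : hmap) (z : option (dart N)).
Definition glueL (x : dart M) : option (dart M + dart N) := Some (inl x).
Definition glueR (x : dart N) : option (dart M + dart N) := Some (inr x).
Definition disj_perm (s : {perm dart M}) (t : {perm dart N}) := lift_opt (sum_perm s t).
(* None is the near end of the new edge, whose far end is the old root half-edge
   of N; the root half-edge of M is kept. *)
Definition gsigma : {perm option (dart M + dart N)} :=
  ((if z is Some z then tperm (glueR z) None else 1) *
   (tperm (glueL (hroot M)) None * disj_perm (hs M) (hs N)))%g.
Definition galpha : {perm option (dart M + dart N)} :=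
  (tperm (glueR (hroot N)) None * disj_perm (ha M) (ha N))%g.
Definition glue := HMap gsigma galpha (glueL (hroot M)).

Lemma disj_permE s t u : disj_perm s t u =
  match u with None => None | Some (inl x) => glueL (s x) | Some (inr y) => glueR (t y) end.
Proof. by rewrite lift_optE; case: u => [[x|y]|] //=; rewrite sum_permE. Qed.

(** When [z] is [Some x], the merged vertex reads [hroot M], then [None], then the cycle of [N] from
    [hs N x] round to [x], then the rest of the root vertex of [M]. Otherwise [None] is just
    inserted after [hroot M]. *)
Lemma glue_s_root : hs glue (glueL (hroot M)) = None.
Proof.
rewrite permM; case: z => [x|]; rewrite ?perm1 permM ?(tpermD (_ : glueR x != _)) //.
all: by rewrite tpermL disj_permE.
Qed.

Lemma glue_s_None : hs glue None =
  if z is Some x then glueR (hs N x) else glueL (hs M (hroot M)).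
Proof.
rewrite permM; case: z => [x|]; rewrite ?perm1 permM ?tpermR ?disj_permE //.
by rewrite tpermD // disj_permE.
Qed.

Lemma glue_s_F x : x != hroot M -> hs glue (glueL x) = glueL (hs M x).
Proof.
move=> xr; rewrite permM.
have -> : (if z is Some z then tperm (glueR z) None else 1)%g (glueL x) = glueL x.
  by case: z => [y|]; rewrite ?perm1 ?tpermD.
by rewrite permM tpermD ?disj_permE // (inj_eq (@Some_inj _)) eq_sym.
Qed.

Lemma glue_s_G x : hs glue (glueR x) =
  if z == Some x then glueL (hs M (hroot M)) else glueR (hs N x).
Proof.
rewrite permM; case: z => [y|]; last by rewrite perm1 permM tpermD ?disj_permE.
rewrite (inj_eq (@Some_inj _)); case: eqP => [->|yx].
  by rewrite tpermL permM tpermR disj_permE.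
by rewrite tpermD ?permM ?tpermD ?disj_permE //; apply/eqP => -[].
Qed.

Lemma glue_a_F x : ha glue (glueL x) = glueL (ha M x).
Proof. by rewrite permM tpermD ?disj_permE. Qed.

Lemma glue_a_G x : x != hroot N -> ha glue (glueR x) = glueR (ha N x).
Proof. by move=> xr; rewrite permM tpermD ?disj_permE // (inj_eq (@Some_inj _)) eq_sym. Qed.

Lemma glue_a_root : ha glue (glueR (hroot N)) = None.
Proof. by rewrite permM tpermL disj_permE. Qed.

Lemma glue_a_None : ha glue None = glueR (ha N (hroot N)).
Proof. by rewrite permM tpermR disj_permE. Qed.

Lemma glue_phi_F x : x != hroot M -> halfrooted M -> hphi glue (glueL x) = glueL (hphi M x).
Proof.
move=> xr hM; rewrite hphiE glue_a_F glue_s_F ?hphiE //.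
by apply: contraNneq xr => e; rewrite -(hM.1 x) e hroot_fixed.
Qed.

Lemma glue_phi_root : halfrooted M -> hphi glue (glueL (hroot M)) = None.
Proof. by move=> hM; rewrite hphiE glue_a_F hroot_fixed // glue_s_root. Qed.

Lemma glue_halfrooted : halfrooted M -> halfrooted N -> halfrooted glue.
Proof.
move=> hM hN; split; case=> [[x|x]|].
- by rewrite !glue_a_F hM.1.
- have [->|xr] := eqVneq x (hroot N); first by rewrite -/(glueR _) glue_a_root glue_a_None hroot_fixed.
  rewrite -/(glueR _) !glue_a_G ?hN.1 //.
  by apply: contraNneq xr => e; rewrite -(hN.1 x) e hroot_fixed.
- by rewrite glue_a_None hroot_fixed // glue_a_root.
- by rewrite -/(glueL x) glue_a_F !(inj_eq (@Some_inj _)); apply: hM.2.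
- have [->|xr] := eqVneq x (hroot N); first by rewrite -/(glueR _) glue_a_root.
  rewrite -/(glueR _) glue_a_G // (inj_eq (@Some_inj _)); apply/negbTE.
  by apply: contraNneq xr => -[/(ha_fixed hN)->].
- by rewrite glue_a_None.
Qed.

(** The root leads to [None], across the new edge to all of [N], and then to [M]: the target of the
    redirected arc out of [hroot M] is entered from [None] or from the attachment dart. *)
Lemma glue_spanning : halfrooted N ->
  spanning (hs M) (ha M) [set hroot M] -> spanning (hs N) (ha N) [set hroot N] ->
  spanning (hs glue) (ha glue) [set hroot glue].
Proof.
move=> hN spM spN S sS aS; rewrite sub1set /= => rS.
have bS : None \in S by rewrite -glue_s_root; apply: sS.
have GS : [set x | glueR x \in S] = setT.
  apply: spN => [x|x|]; rewrite ?sub1set !inE.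
  - move=> xS; have := sS _ xS; rewrite glue_s_G; case: eqP => // zx _.
    by have := sS _ bS; rewrite glue_s_None zx.
  - have [->|xr] := eqVneq x (hroot N); first by rewrite hroot_fixed.
    by move=> /aS; rewrite glue_a_G.
  - by have := aS _ bS; rewrite glue_a_None hroot_fixed.
have FS : [set x | glueL x \in S] = setT.
  apply: spM => [x|x|]; rewrite ?sub1set !inE //; last by rewrite -glue_a_F => /aS.
  have [->|xr] := eqVneq x (hroot M); last by rewrite -glue_s_F // => /sS.
  move=> _; case E: z => [y|]; last by have := sS _ bS; rewrite glue_s_None E.
  have : glueR y \in S by have /setP/(_ y) := GS; rewrite !inE.
  by move/sS; rewrite glue_s_G E eqxx.
apply/setP => -[[x|x]|]; rewrite inE.
- by have /setP/(_ x) := FS; rewrite !inE.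
- by have /setP/(_ x) := GS; rewrite !inE.
- by [].
Qed.

Lemma porbits_disj (s : {perm dart M}) (t : {perm dart N}) :
  #|porbits (disj_perm s t)| = (#|porbits s| + #|porbits t|).+1.
Proof. by rewrite porbits_lift_opt porbits_sum_perm. Qed.

Lemma disj_mul (s s' : {perm dart M}) (t t' : {perm dart N}) :
  (disj_perm s t * disj_perm s' t' = disj_perm (s * s') (t * t'))%g.
Proof. by rewrite lift_optM sum_permM. Qed.

Lemma notin_disj (s : {perm dart M}) (t : {perm dart N}) u :
  u != None -> u \notin porbit (disj_perm s t) None.
Proof.
move=> uN; apply/negP => /(porbit_invariant (f := fun u => u == None)) e.
by move: uN; rewrite e // => -[[v|v]|]; rewrite disj_permE.
Qed.

Lemma notin_root_disj (s : {perm dart M}) (t : {perm dart N}) x :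
  glueR x \notin porbit (tperm (glueL (hroot M)) None * disj_perm s t) None.
Proof.
apply/negP => /(porbit_invariant (f := fun u => if u is Some (inr _) then true else false)) e.
suff: true = false by []; apply: e => u.
by rewrite permM; case: tpermP => [->|->|_ _]; rewrite disj_permE //; case: u => [[v|v]|].
Qed.

(* In the bridge case the new edge merges two faces; otherwise attaching it at z
   merges two vertices, while the face of N is first merged, then split again. *)
Lemma glue_euler : halfrooted M -> halfrooted N ->
  (if z is Some x then hs N x \in porbit (hphi N) (hroot N) else true) ->
  (euler (hs glue) (ha glue)).+1 = euler (hs M) (ha M) + euler (hs N) (ha N).
Proof.
move=> hM hN hz; set s0 := disj_perm (hs M) (hs N); set a0 := disj_perm (ha M) (ha N).
have E : #|porbits (ha glue)| = #|porbits (ha M)| + #|porbits (ha N)|.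
  by apply/succn_inj; rewrite porbits_merge ?porbits_disj ?notin_disj.
set t1 := tperm (glueL (hroot M)) None.
have V1 : #|porbits (t1 * s0)| = #|porbits (hs M)| + #|porbits (hs N)|.
  by apply/succn_inj; rewrite porbits_merge ?porbits_disj ?notin_disj.
set P1 := (t1 * disj_perm (hphi M) (hphi N))%g.
have F1 : #|porbits P1| = #|porbits (hphi M)| + #|porbits (hphi N)|.
  by apply/succn_inj; rewrite porbits_merge ?porbits_disj ?notin_disj.
(* [a0] fixes both points exchanged by [t1], so the two commute. *)
have P1E : (a0 * (t1 * s0) = P1)%g.
  have -> : t1 = tperm (a0 (glueL (hroot M))) (a0 None).
    by rewrite [a0 (glueL _)]disj_permE [a0 None]disj_permE /= hroot_fixed.
  by rewrite mulgA mul_tperm /P1 -disj_mul mulgA.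
rewrite /euler E; case Ez: z hz => [x|] hz.
  have V : #|porbits (hs glue)|.+1 = #|porbits (hs M)| + #|porbits (hs N)|.
    by rewrite /= /gsigma Ez porbits_merge ?notin_root_disj.
  (* Carried across [ha N], the attachment dart [x] becomes its mate [w], and [hphi N w = hs N x]
     lies on the outer face by hypothesis. *)
  set w := ha N x; set P2 := (tperm (glueR w) None * P1)%g.
  have F2 : #|porbits P2|.+1 = #|porbits (hphi M)| + #|porbits (hphi N)|.
    by rewrite porbits_merge ?notin_root_disj.
  have phiE : hphi glue = (tperm (glueR (hroot N)) None * P2)%g.
    have cm : (a0 * tperm (glueR x) None = tperm (glueR w) None * a0)%g.
      rewrite -mul_tperm [a0 None]disj_permE [a0 (glueR w)]disj_permE /=.
      by rewrite /w hN.1.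
    rewrite /hphi /= /gsigma Ez /galpha /P2 -P1E -/a0 -/s0 -/t1.
    by rewrite [(_ None * (a0 * _))%g]mulgA -cm !mulgA.
  have wP2 : glueR w \in porbit P2 None by rewrite porbit_tperm_merge ?notin_root_disj.
  have P2None : P2 None = glueR (hphi N w).
    by rewrite permM tpermR permM tpermD ?disj_permE.
  (* The merged orbit of [None] contains the whole old face of [w], which is the outer face of [N];
     the last transposition therefore splits it. *)
  have rP2 : glueR (hroot N) \in porbit P2 None.
    suff : hroot N \in [set y | glueR y \in porbit P2 None] by rewrite inE.
    apply: (@stable_porbit _ (hphi N) _ w); rewrite ?inE //; last first.
      by rewrite -porbit_perm1 hphiE /w hN.1 porbit_sym.
    move=> y; rewrite !inE; have [-> _|yw] := eqVneq y w.
      by rewrite -P2None -porbit_perm1 porbit_id.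
    move/(@porbit_stable _ P2); rewrite permM tpermD ?(inj_eq (@Some_inj _)) 1?eq_sym //.
    by rewrite permM tpermD ?disj_permE.
  have F := porbits_split (isT : glueR (hroot N) != None) rP2.
  (* One face is lost and regained, and one vertex is lost. *)
  have aux (v em en f p fm fn vm vn : nat) : f = p.+1 -> p.+1 = fm + fn ->
      v.+1 = vm + vn -> (v + (em + en) + f).+1 = vm + em + fm + (vn + en + fn) by lia.
  by move: F F2 V; rewrite -phiE; apply: aux.
have V : #|porbits (hs glue)| = #|porbits (hs M)| + #|porbits (hs N)|.
  by rewrite -V1 /= /gsigma Ez mul1g.
have phiE : hphi glue = (tperm (glueR (hroot N)) None * P1)%g.
  by rewrite /hphi /= /gsigma Ez /galpha mul1g -P1E -mulgA.
(* Bridge case: one face is lost and no vertex. *)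
have F := porbits_merge (notin_root_disj (hphi M) (hphi N) (hroot N)).
have aux (v em en f p fm fn vm vn : nat) : f.+1 = p -> p = fm + fn ->
    v = vm + vn -> (v + (em + en) + f).+1 = vm + em + fm + (vn + en + fn) by lia.
move: F F1 V; rewrite -/P1 -/t1 -phiE. exact: aux.
Qed.

End Glue.

(** [K] factors through [k], so it takes no more values. Applied in both directions, it lets a
    complete invariant of the vertices count them. *)
Lemma leq_card_imset (T A B : finType) (K : T -> A) (k : T -> B) (W : {set T}) :
  (forall x y, k x = k y -> K x = K y) -> #|K @: W| <= #|k @: W|.
Proof.
move=> kK; have [->|[x0 _]] := set_0Vmem W; first by rewrite !imset0 cards0.
pose h v := K (odflt x0 [pick x in W | k x == v]).
apply: leq_trans (leq_imset_card h _); apply: subset_leq_card.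
apply/subsetP => _ /imsetP[x xW ->]; apply/imsetP; exists (k x); first exact: imset_f.
rewrite /h; case: pickP => [y /andP[_ /eqP e]|/(_ x)]; first exact/kK.
by rewrite xW eqxx.
Qed.

Lemma cornerP N j : halfrooted N -> j <= size (walk N) ->
  if corner N j is Some x then j < size (walk N) /\ hs N x = step N j
  else j = size (walk N).
Proof.
move=> hN jd; rewrite /corner; case: ltnP => h; first by rewrite permKV.
by apply/eqP; rewrite eqn_leq jd.
Qed.

(** * The outer face of a glued map *)

Section GlueWalk.
Variables (M N : hmap) (j : nat).
Let z := corner N j.
Let G := glue M z.
Let F : dart M -> dart G := @glueL M N.
Let H : dart N -> dart G := @glueR M N.

Lemma corner_face : if z is Some x then hs N x \in porbit (hphi N) (hroot N) else true.
Proof.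
by rewrite /z /corner; case: ifP => // _; rewrite permKV step_mem.
Qed.

(* Names the vertex of u: the vertex z of N is absorbed by the root vertex of M. *)
Definition vclass (u : dart G) : {set dart M} + {set dart N} :=
  match u with
  | None => inl (porbit (hs M) (hroot M))
  | Some (inl x) => inl (porbit (hs M) x)
  | Some (inr x) =>
      if z is Some y then
        if x \in porbit (hs N) y then inl (porbit (hs M) (hroot M))
        else inr (porbit (hs N) x)
      else inr (porbit (hs N) x)
  end.

Lemma vclass_s u : vclass (hs G u) = vclass u.
Proof.
case: u => [[x|x]|].
- have [->|xr] := eqVneq x (hroot M); first by rewrite -/(@glueL M N _) glue_s_root.
  by rewrite -/(@glueL M N _) glue_s_F //= porbit_perm1.
- rewrite -/(@glueR M N _) glue_s_G /vclass; case: z => [y|] /=; last by rewrite porbit_perm1.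
  rewrite (inj_eq (@Some_inj _)); case: eqP => [->|_] /=.
    by rewrite porbit_id porbit_perm1.
  by rewrite -!eq_porbit_mem porbit_perm1.
- rewrite glue_s_None /vclass; case: z => [y|] /=; last by rewrite porbit_perm1.
  by rewrite -eq_porbit_mem porbit_perm1 eqxx.
Qed.

Lemma vclass_porbit u v : v \in porbit (hs G) u -> vclass v = vclass u.
Proof. exact: (porbit_invariant vclass_s). Qed.

Local Notation K := (porbit (hs G)).

Lemma porbit_None : K None = K (F (hroot M)).
Proof. by rewrite -[RHS]porbit_perm1 glue_s_root. Qed.

(** Only the arc out of [y] is redirected. If [y] were not in [S], the darts of [N] at the vertex of
    [None], then [S] would be stable under [hs N]; but it contains [hs N y]. *)
Lemma porbit_corner y : z = Some y -> K (H y) = K (F (hroot M)).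
Proof.
move=> zy; rewrite -porbit_None; pose S := [set x | K (H x) == K None].
have sy : hs N y \in S.
  by rewrite inE -[X in _ == X]porbit_perm1 glue_s_None zy.
have [|yS] := boolP (y \in S); first by rewrite inE => /eqP.
have /stable_mem sS : stable (hs N) S.
  move=> x; have [->|xy] := eqVneq x y; first by rewrite (negPf yS).
  rewrite !inE => /eqP <-; rewrite -[X in _ == X]porbit_perm1 glue_s_G zy.
  by have [[yx]|_] := Some y =P Some x; first by rewrite yx eqxx in xy.
by move: sy; rewrite sS (negPf yS).
Qed.

Lemma porbit_H x y : porbit (hs N) x = porbit (hs N) y -> K (H x) = K (H y).
Proof.
have inv u : K (H (hs N u)) = K (H u).
  have [zu|zu] := z =P Some u; last first.
    by rewrite -[RHS]porbit_perm1 glue_s_G; move/eqP/negPf: zu => ->.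
  by rewrite (porbit_corner zu) -porbit_None -[RHS]porbit_perm1 glue_s_None zu.
move/eqP; rewrite eq_porbit_mem.
exact: (porbit_invariant (f := fun u => K (H u)) inv).
Qed.

Lemma porbit_F x y : porbit (hs M) x = porbit (hs M) y -> K (F x) = K (F y).
Proof.
have inv u : K (F (hs M u)) = K (F u).
  have [->|ur] := eqVneq u (hroot M); last by rewrite -[RHS]porbit_perm1 glue_s_F.
  case Ez: z => [v|]; last by rewrite -porbit_None -[RHS]porbit_perm1 glue_s_None Ez.
  by rewrite -(porbit_corner Ez) -[RHS]porbit_perm1 glue_s_G Ez eqxx.
move/eqP; rewrite eq_porbit_mem.
exact: (porbit_invariant (f := fun u => K (F u)) inv).
Qed.

(** With [vclass_porbit], this makes [vclass] a complete invariant of the vertices. *)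
Lemma porbit_vclass u v : vclass u = vclass v -> K u = K v.
Proof.
have vH x : (exists2 y, z = Some y & x \in porbit (hs N) y /\ vclass (H x) = vclass None) \/
            vclass (H x) = inr (porbit (hs N) x).
  rewrite /=; case: z => [y|]; last by right.
  by case: ifP => xy; [left; exists y | right].
have KH y x : z = Some y -> x \in porbit (hs N) y -> K (H x) = K None.
  move=> zy; rewrite -eq_porbit_mem => /eqP/porbit_H->.
  by rewrite (porbit_corner zy) porbit_None.
case: u => [[u|u]|]; case: v => [[v|v]|]; rewrite -?/(F _) -?/(H _) //.
- by case=> /porbit_F.
- case: (vH v) => [[y zy [vy ->]]|-> //].
  by case=> /porbit_F->; rewrite (KH y) // porbit_None.
- by case=> /porbit_F->; rewrite porbit_None.
- case: (vH u) => [[y zy [uy ->]]|-> //].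
  by case=> /porbit_F<-; rewrite (KH y) // porbit_None.
- case: (vH u) => [[y zy [uy ->]]|->]; case: (vH v) => [[y' zy' [vy' ->]]|->] //.
    by rewrite (KH y) // (KH y').
  by case=> /porbit_H.
- by case: (vH u) => [[y zy [uy ->]]|-> //]; rewrite (KH y).
- by case=> /porbit_F<-; rewrite porbit_None.
- by case: (vH v) => [[y zy [vy ->]]|-> //]; rewrite (KH y).
Qed.

Hypotheses (hM : halfrooted M) (hN : halfrooted N) (adm : admissible N j).

Lemma glue_step0 : step G 0 = None.
Proof. exact: glue_phi_root. Qed.

Lemma glue_phi_None : hphi G None = hs G (H (hroot N)).
Proof. by rewrite hphiE glue_a_None hroot_fixed. Qed.

(** [None] comes first, so the walk of [N] is delayed by one. It could deviate only after [hroot N]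
    or at the arc out of [z], and neither affects the steps before time [j]. *)
Lemma glue_step i : i < j -> step G i.+1 = H (step N i).
Proof.
have [jd first] := adm; have := cornerP hN jd; rewrite -/z => zP.
have nz k u : k < j -> step N k = hs N u -> z == Some u = false.
  move=> kj ku; apply/eqP => zu; move: zP; rewrite zu => -[jd' yj].
  by have := first jd' k kj; rewrite -yj ku porbit_id.
have s0 : step N 0 = hs N (hroot N) by rewrite /step /= hphiE hroot_fixed.
elim: i => [|i IHi] ij.
  by rewrite stepS glue_step0 glue_phi_None glue_s_G (nz 0) // s0.
rewrite stepS IHi ?(ltnW ij) // hphiE.
have /eqP nr := step_nroot ij jd.
by rewrite glue_a_G // glue_s_G (nz i.+1) // stepS hphiE.
Qed.

(** Here the walk leaves [N], along the redirected arc out of [z] or, for a new vertex, from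
    [hroot N] across the new edge to [None]. Both ways enter the outer face of [M]. *)
Lemma glue_step_j : step G j.+1 = F (hs M (hroot M)).
Proof.
have [jd first] := adm; have := cornerP hN jd; rewrite -/z => zP.
have [j0|jp] := posnP j.
  have -> : step G j.+1 = hphi G None by rewrite [X in step G X.+1]j0 stepS glue_step0.
  rewrite glue_phi_None glue_s_G; case: eqP => //; case: z zP => [x|] zP.
    case: zP => _ xj []; congr Some; apply: (@perm_inj _ (hs N)).
    by rewrite xj j0 /step /= hphiE hroot_fixed.
  by have := size_walk_gt0 N; rewrite -zP j0.
have cj : step G j = H (step N j.-1) by rewrite -glue_step ?prednK.
have sj : hphi N (step N j.-1) = step N j by rewrite -stepS prednK.
rewrite stepS cj hphiE; case Ez: z zP => [x|] zP.
  have [jd' xj] := zP.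
  have /eqP nr : step N j.-1 <> hroot N by apply: step_nroot (leqnn _); rewrite prednK.
  rewrite glue_a_G // glue_s_G Ez; case: eqP => // -[]; congr Some.
  by apply: (@perm_inj _ (hs N)); rewrite xj -sj hphiE.
by rewrite zP step_last glue_a_root glue_s_None Ez.
Qed.

Lemma glue_face : porbit (hphi G) (hroot G) =
  None |: ([set H (step N (nat_of_ord i)) | i : 'I_j] :|: F @: porbit (hphi M) (hroot M)).
Proof.
set W := (_ |: _); set r := hroot M.
have rW : hroot G \in W by rewrite !inE imset_f ?orbT ?porbit_id.
have srW : F (hs M r) \in W.
  have <- : hphi M r = hs M r by rewrite hphiE hroot_fixed.
  by rewrite !inE imset_f ?orbT // porbit_stable ?porbit_id.
have HW i : i < j -> H (step N i) \in W.
  move=> ij; rewrite !inE; apply/orP; right; apply/orP; left.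
  by apply/imsetP; exists (Ordinal ij).
have stepW i : i <= j -> step G i.+1 \in W.
  by rewrite leq_eqVlt => /orP[/eqP->|ij]; rewrite ?glue_step_j // glue_step // HW.
apply/eqP; rewrite eqEsubset; apply/andP; split; apply/subsetP => u.
  apply: stable_porbit => // v /setU1P[->|/setUP[/imsetP[i _ ->]|/imsetP[x xf ->]]].
  - by rewrite -glue_step0 -stepS stepW.
  - by rewrite -glue_step // -stepS stepW.
  - have [->|xr] := eqVneq x r; first by rewrite glue_phi_root // !inE eqxx.
    by rewrite glue_phi_F // !inE imset_f ?orbT //; apply: porbit_stable.
have stepG i : step G i \in porbit (hphi G) (hroot G) := step_mem G i.
rewrite !inE => /or3P[/eqP->|/imsetP[i _ ->]|/imsetP[x xf ->]].
- by rewrite -glue_step0.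
- by rewrite -glue_step.
suff : x \in [set x | F x \in porbit (hphi G) (hroot G)] by rewrite inE.
apply: (stable_porbit _ _ xf); last by rewrite inE porbit_id.
move=> y; rewrite !inE; have [-> _|yr] := eqVneq y r.
  by rewrite hphiE hroot_fixed // -/F -glue_step_j.
by rewrite -[F (hphi M y)](@glue_phi_F M N z y yr hM); apply: porbit_stable.
Qed.

(** The vertices of [N] met before time [j] differ from that of [z], whose first visit is at [j].
    Hence none of them is absorbed by the root vertex of [M], and the two counts add up. *)
Lemma glue_outer : outer G = outer M + seen N j.
Proof.
have [jd first] := adm; have := cornerP hN jd; rewrite -/z => zP.
have -> : outer G = #|vclass @: porbit (hphi G) (hroot G)|.
  rewrite outerE; apply/eqP; rewrite eqn_leq; apply/andP; split; apply: leq_card_imset.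
    exact: porbit_vclass.
  by move=> u v /eqP; rewrite eq_porbit_mem => /vclass_porbit.
have -> : vclass @: porbit (hphi G) (hroot G) =
    (fun S => inl S) @: (porbit (hs M) @: porbit (hphi M) (hroot M)) :|:
    (fun S => inr S) @: [set S in take j (verts N)].
  rewrite glue_face imsetU1 imsetU -!imset_comp; apply/setP => S; rewrite !inE.
  have vH i : i < j -> vclass (H (step N i)) = inr (porbit (hs N) (step N i)).
    move=> ij; rewrite /=; case: z zP => // x [jd' xj].
    by have := first jd' _ ij; rewrite -xj porbit_perm1 => /negPf->.
  apply/or3P/orP => [[/eqP->|/imsetP[i _ ->]|/imsetP[x xf ->]]|[/imsetP[x xf ->]|/imsetP[V]]].
  - by left; apply/imsetP; exists (hroot M); rewrite ?porbit_id.
  - right; rewrite [X in X \in _](vH i (ltn_ord i)); apply: imset_f; rewrite inE take_verts //.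
    by apply: (map_f (fun i => porbit (hs N) (step N i))); rewrite mem_iota /=.
  - by left; apply/imsetP; exists x.
  - by apply: Or33; apply/imsetP; exists x.
  rewrite inE take_verts // => /mapP[i]; rewrite mem_iota /= add0n => ij -> ->.
  by apply: Or32; apply/imsetP; exists (Ordinal ij); rewrite // [RHS](vH i ij).
rewrite cardsU disjoint_setI0 ?cards0 ?subn0.
  rewrite card_imset => [|? ? []//]; rewrite [X in _ + X]card_imset => [|? ? []//].
  rewrite -outerE /seen; congr (_ + _); rewrite -(card_uniqP (undup_uniq _)).
  by apply: eq_card => S; rewrite inE mem_undup.
by rewrite disjoint_subset; apply/subsetP => _ /imsetP[S _ ->]; rewrite inE; apply/imsetP => -[].
Qed.

End GlueWalk.

(** * Gluing and isomorphisms *)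

Lemma glue_iso M N M2 N2 (p : dart M -> dart M2) (q : dart N -> dart N2) z :
  bijective p -> morph p -> bijective q -> morph q ->
  iso (glue M z) (glue M2 (omap q z)).
Proof.
case=> p' pK p'K [ps pa pr] [q' qK q'K] [qs qa qr].
pose f (g : dart M -> dart M2) (h : dart N -> dart N2) u : option (dart M2 + dart N2) :=
  match u with None => None | Some (inl x) => glueL N2 (g x) | Some (inr x) => glueR M2 (h x) end.
pose f' (u : option (dart M2 + dart N2)) : option (dart M + dart N) :=
  match u with None => None | Some (inl x) => glueL N (p' x) | Some (inr x) => glueR M (q' x) end.
exists (f p q).
  by exists f'; case=> [[x|x]|] //=; rewrite ?pK ?qK ?p'K ?q'K.
have fF x : f p q (glueL N x) = glueL N2 (p x) by [].
have fG x : f p q (glueR M x) = glueR M2 (q x) by [].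
have fN : f p q None = None by [].
have zE x : (omap q z == Some (q x)) = (z == Some x).
  by case: z => // y; rewrite /= !(inj_eq (@Some_inj _)) (can_eq qK).
split; last by rewrite fF pr.
- case=> [[x|x]|]; rewrite -?/(glueL N x) -?/(glueR M x).
  + have [->|xr] := eqVneq x (hroot M); first by rewrite fF pr !glue_s_root.
    by rewrite !fF !glue_s_F ?fF ?ps // -pr (can_eq pK).
  + by rewrite fG !glue_s_G zE; case: eqP => _; rewrite ?fF ?fG ?ps ?pr ?qs.
  + by clear zE; rewrite fN !glue_s_None; case: z => [y|] /=; rewrite ?fF ?fG ?ps ?pr ?qs.
- case=> [[x|x]|]; rewrite -?/(glueL N x) -?/(glueR M x).
  + by rewrite fF !glue_a_F fF pa.
  + have [->|xr] := eqVneq x (hroot N); first by rewrite fG qr !glue_a_root.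
    by rewrite fG !glue_a_G ?fG ?qa // -qr (can_eq qK).
  + by rewrite fN !glue_a_None fG qa qr.
Qed.

(** The walk starts with [None], itself at the root vertex, and first returns there at time [j + 1];
    this determines [j] from the glued map. *)
Lemma glue_return M N j : halfrooted M -> halfrooted N -> admissible N j ->
  let G := glue M (corner N j) in
  (forall i, i < j -> step G i.+1 \notin porbit (hs G) (hroot G)) /\
  step G j.+1 \in porbit (hs G) (hroot G).
Proof.
move=> hM hN adm G; have [jd first] := adm; have zP := cornerP hN jd.
split=> [i ij|].
  rewrite glue_step //; apply/negP => /vclass_porbit /=.
  case: (corner N j) zP => // x [jd' xj].
  by have := first jd' _ ij; rewrite -xj porbit_perm1 => /negPf->.
rewrite glue_step_j // -eq_porbit_mem; apply/eqP; apply: porbit_F.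
exact: porbit_perm1.
Qed.

Lemma glue_inj M N M2 N2 j j2 :
  halfrooted M -> halfrooted N -> halfrooted M2 -> halfrooted N2 ->
  spanning (hs M) (ha M) [set hroot M] -> spanning (hs N) (ha N) [set hroot N] ->
  spanning (hs M2) (ha M2) [set hroot M2] -> spanning (hs N2) (ha N2) [set hroot N2] ->
  admissible N j -> admissible N2 j2 ->
  iso (glue M (corner N j)) (glue M2 (corner N2 j2)) ->
  [/\ iso M M2, iso N N2 & j = j2].
Proof.
move=> hM hN hM2 hN2 spM spN spM2 spN2 adm adm2 [p pB pm].
set G := glue M _ in p pB pm *; set G2 := glue M2 _ in p pB pm *.
have pI := bij_inj pB; have [ps pa pr] := pm.
have pstep i : p (step G i) = step G2 i.
  by elim: i => [|i IHi]; rewrite ?stepS (morph_phi _ pm) ?IHi // pr.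
have pP x : (p x \in porbit (hs G2) (hroot G2)) = (x \in porbit (hs G) (hroot G)).
  by rewrite -pr (mem_imset_porbit _ _ pI ps).
have jj : j = j2.
  have [r1 r2] := glue_return hM hN adm; have [r1' r2'] := glue_return hM2 hN2 adm2.
  apply/eqP; rewrite eqn_leq; apply/andP; split; rewrite leqNgt; apply/negP => lt.
    by move: (r1 _ lt); rewrite -pP pstep r2'.
  by move: (r1' _ lt); rewrite -pstep pP r2.
have pN : p None = None by rewrite -(glue_s_root M (corner N j)) ps pr glue_s_root.
have py : p (glueL N (hs M (hroot M))) = glueL N2 (hs M2 (hroot M2)).
  by rewrite -(glue_step_j hM hN adm) pstep jj (glue_step_j hM2 hN2 adm2).
have pFr : p (glueL N (hroot M)) = glueL N2 (hroot M2) := pr.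
have pGr : p (glueR M (hroot N)) = glueR M2 (hroot N2).
  by rewrite -[in LHS](hroot_fixed hN) -(glue_a_None M (corner N j)) pa pN glue_a_None hroot_fixed.
(* The darts of [M] sent into [M2] form a stable set containing the root; [py] takes care of the
   redirected arc out of [hroot M]. *)
have pF x : exists x2, p (glueL N x) = glueL N2 x2.
  have /setP/(_ x) : [set x | if p (glueL N x) is Some (inl _) then true else false] = setT.
    apply: spM => [y|y|]; rewrite ?sub1set !inE ?pr //.
    - have [->|yr] := eqVneq y (hroot M); first by rewrite py.
      rewrite -(glue_s_F (corner N j) yr) ps.
      case e: (p _) => [[y2|y2]|] // _; rewrite glue_s_F //.
      by apply: contraNneq yr => y2r; have := e; rewrite y2r -/(glueL N2 _) -pFr => /pI [->].
    - rewrite -(glue_a_F (corner N j) _) pa.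
      by case e: (p _) => [[y2|y2]|] // _; rewrite glue_a_F.
  by rewrite !inE; case e: (p _) => [[x2|x2]|] // _; exists x2.
have pG x : exists x2, p (glueR M x) = glueR M2 x2.
  have /setP/(_ x) : [set x | if p (glueR M x) is Some (inr _) then true else false] = setT.
    apply: spN => [y|y|]; rewrite ?sub1set !inE ?pGr //.
    - case e: (p (glueR M y)) => [[y2|y2]|] // _.
      (* An image leaving [N2] could only be the target of the redirected arc, which by [py] is
         already the image of a dart of [M]. *)
      suff : p (glueR M (hs N y)) = hs G2 None \/ p (glueR M (hs N y)) = hs G2 (glueR M2 y2).
        rewrite glue_s_None glue_s_G; case=> e2; rewrite e2 //; move: e2; last first.
          by case: ifP => // _; rewrite -py => /pI.
        by case: (corner N2 j2) => //; rewrite -py => /pI.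
      have [zy|/eqP/negPf zy] := corner N j =P Some y; [left|right].
        by rewrite -pN -ps glue_s_None zy.
      by rewrite -[glueR M2 y2]e -ps glue_s_G zy.
    - have [->|yr] := eqVneq y (hroot N); first by rewrite hroot_fixed.
      rewrite -(glue_a_G M (corner N j) yr) pa.
      case e: (p (glueR M y)) => [[y2|y2]|] // _; rewrite glue_a_G //.
      by apply: contraNneq yr => y2r; have := e; rewrite y2r -/(glueR M2 _) -pGr => /pI [->].
  by rewrite !inE; case e: (p _) => [[x2|x2]|] // _; exists x2.
pose pM x := if p (glueL N x) is Some (inl x2) then x2 else hroot M2.
pose qN x := if p (glueR M x) is Some (inr x2) then x2 else hroot N2.
have pME x : p (glueL N x) = glueL N2 (pM x) by rewrite /pM; case: (pF x) => x2 ->.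
have qNE x : p (glueR M x) = glueR M2 (qN x) by rewrite /qN; case: (pG x) => x2 ->.
have FI (A B : finType) : injective (fun x : A => Some (inl x) : option (A + B)) by move=> ? ? [].
have GI (A B : finType) : injective (fun x : B => Some (inr x) : option (A + B)) by move=> ? ? [].
have pMI : injective pM by move=> x x' e; apply: (FI _ (dart N)); apply: pI; rewrite -!/(glueL _ _) !pME e.
have qNI : injective qN by move=> x x' e; apply: (GI (dart M)); apply: pI; rewrite -!/(glueR _ _) !qNE e.
have pMr : pM (hroot M) = hroot M2 by rewrite /pM pFr.
have qNr : qN (hroot N) = hroot N2 by rewrite /qN pGr.
have pMm : morph pM.
  split=> // x; apply: (FI _ (dart N2)); rewrite -!/(glueL _ _) -pME.
    have [->|xr] := eqVneq x (hroot M); first by rewrite py pMr.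
    by rewrite -(glue_s_F (corner N j) xr) ps pME glue_s_F // -pMr (inj_eq pMI).
  by rewrite -(glue_a_F (corner N j) _) pa pME glue_a_F.
have qNm : morph qN.
  split=> // x; apply: (GI (dart M2)); rewrite -!/(glueR _ _) -qNE; last first.
    have [->|xr] := eqVneq x (hroot N); first by rewrite hroot_fixed // qNr hroot_fixed.
    by rewrite -(glue_a_G M (corner N j) xr) pa qNE glue_a_G // -qNr (inj_eq qNI).
  have [zx|/eqP/negPf zx] := corner N j =P Some x.
    have : hs G2 (glueR M2 (qN x)) = glueL N2 (hs M2 (hroot M2)).
      by rewrite -qNE -ps glue_s_G zx eqxx py.
    rewrite glue_s_G; case: eqP => // zq _.
    have : p (glueR M (hs N x)) = hs G2 None by rewrite -pN -ps glue_s_None zx.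
    by rewrite glue_s_None zq.
  have : p (glueR M (hs N x)) = hs G2 (glueR M2 (qN x)) by rewrite -qNE -ps glue_s_G zx.
  by rewrite glue_s_G; case: ifP => // _; rewrite -py => /pI.
split=> //; [exists pM | exists qN] => //; exact: inj_morph_bij.
Qed.

(** * Removing the root edge *)

Definition restr_fun (T : finType) (s : {perm T}) (P : pred T)
  (h : forall x, P x -> P (s x)) (u : {x | P x}) : {x | P x} :=
  exist _ (s (val u)) (h _ (valP u)).

Lemma restr_inj (T : finType) (s : {perm T}) (P : pred T) (h : forall x, P x -> P (s x)) :
  injective (restr_fun h).
Proof. by move=> u v /(congr1 val) /perm_inj /val_inj. Qed.

Definition restr (T : finType) (s : {perm T}) (P : pred T) (h : forall x, P x -> P (s x)) :
  {perm {x | P x}} := perm (@restr_inj T s P h).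

Lemma val_restr (T : finType) (s : {perm T}) (P : pred T) (h : forall x, P x -> P (s x)) u :
  val (restr h u) = s (val u).
Proof. by rewrite permE. Qed.

Lemma spanning_restr (T : finType) (s a : {perm T}) (P : pred T) (hs : forall x, P x -> P (s x))
    (ha : forall x, P x -> P (a x)) (r : {x | P x}) :
  (forall W : {set T}, W \subset P -> stable s W -> stable a W -> val r \in W ->
      forall x, P x -> x \in W) ->
  spanning (restr hs) (restr ha) [set r].
Proof.
move=> h S sS aS; rewrite sub1set => rS; apply/setP => x; rewrite inE.
have memS u : (val u \in val @: S) = (u \in S) by rewrite mem_imset //; apply: val_inj.
rewrite -memS; apply: h; rewrite ?memS ?(valP x) //.
- by apply/subsetP => _ /imsetP[u _ ->]; apply: (valP u).
- by move=> _ /imsetP[u uS ->]; rewrite -(val_restr hs) memS; apply: sS.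
- by move=> _ /imsetP[u uS ->]; rewrite -(val_restr ha) memS; apply: aS.
Qed.

Lemma step_periodic M i : step M (i + size (walk M)) = step M i.
Proof.
rewrite /step iterD -/(step M (size (walk M))).
have -> : step M (size (walk M)) = hphi M (hroot M); last by [].
by rewrite -[in LHS](prednK (size_walk_gt0 M)) stepS step_last.
Qed.

Lemma step_neq M i j : i < j -> j < size (walk M) -> step M i <> step M j.
Proof.
by move=> ij jd /(step_inj (ltn_trans ij jd) jd) e; rewrite e ltnn in ij.
Qed.

(** The root half-edge ends the walk and lies at the root vertex, so a return exists. Time 0 is
    already a visit, hence the shift to [k.+1]. *)
Lemma first_return M : hs M (hroot M) != hroot M -> halfrooted M ->
  exists k, [/\ k.+1 < size (walk M), step M k.+1 \in porbit (hs M) (hroot M)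
    & forall i, i < k -> step M i.+1 \notin porbit (hs M) (hroot M)].
Proof.
move=> br hM; pose Q k := step M k.+1 \in porbit (hs M) (hroot M).
have s0 : step M 0 = hs M (hroot M) by rewrite /step /= hphiE hroot_fixed.
have d2 : 1 < size (walk M).
  rewrite ltn_neqAle size_walk_gt0 andbT; apply/eqP => d1.
  by case/eqP: br; rewrite -s0 -[RHS]step_last -d1.
have Qd : Q (size (walk M)).-2.
  have e : (size (walk M)).-2.+1 = (size (walk M)).-1 by lia.
  by rewrite /Q e step_last porbit_id.
have exQ : exists k, Q k by exists (size (walk M)).-2.
case: (ex_minnP exQ) => k Qk mink; exists k; split => //.
  by have := mink _ Qd; lia.
by move=> i ik; apply/negP => /mink; rewrite leqNgt ik.
Qed.

(* Cutting the root vertex at y gives (s1, ha M), still connected with the same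
   Euler sum; since both ends of the root edge then lie on one face, deleting it
   raises the sum above the bound of a connected map, whence S. *)
Lemma decompose M : valid M -> 1 < #|dart M| ->
  exists M' N j, [/\ valid M', valid N, admissible N j & iso M (glue M' (corner N j))].
Proof.
case=> hM spM eM T1; set r := hroot M; set b := hs M r; set a := ha M b.
have br : b != r.
  apply/eqP => bre; have /setP sT : [set r] = setT.
    apply: spM => [x|x|]; rewrite ?subxx // !inE => /eqP->; first by rewrite -/b bre.
    by rewrite hroot_fixed.
  have := cards1 r; have -> : [set r] = setT by apply/setP.
  by rewrite cardsT; lia.
have ab : a != b by rewrite hM.2.
have [k [kd yP first]] := first_return br hM; set P := porbit _ _ in yP first.
have s0 : step M 0 = b by rewrite /step /= hphiE hroot_fixed.
(* [z] precedes [y] around the root vertex and is the mate of [step M k]. *)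
set y := step M k.+1 in yP; set z := ha M (step M k).
have zy : hs M z = y by rewrite /y stepS hphiE.
have az : ha M z = step M k by rewrite hM.1.
have bP : b \in P by rewrite porbit_stable ?porbit_id.
have zP : z \in P by rewrite -(stable_mem _ (@porbit_stable _ _ _)) -/P zy.
have zr : z != r.
  apply/eqP => zr; have : step M 0 = step M k.+1 by rewrite -/y -zy zr s0.
  exact: step_neq.
(* [s1] cuts the root vertex into the cycle through [r], [b], [y] and the cycle from [hs M b] to
   [z]; if [z = b], nothing is cut. [a2] makes both ends of the root edge fixed points. *)
set s1 := (tperm z b * hs M)%g; set a2 := (tperm a b * ha M)%g.
have s1z : s1 z = hs M b by rewrite permM tpermL.
have s1b : s1 b = y by rewrite permM tpermR.
have s1E x : x != z -> x != b -> s1 x = hs M x by move=> xz xb; rewrite permM tpermD // eq_sym.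
have s1r : s1 r = b by rewrite s1E // eq_sym.
have a2a : a2 a = a by rewrite permM tpermL.
have a2b : a2 b = b by rewrite permM tpermR /a hM.1.
have a2E x : x != a -> x != b -> a2 x = ha M x by move=> xz xb; rewrite permM tpermD // eq_sym.
set phi1 := (ha M * s1)%g.
have na i : i < k -> step M i != a.
  move=> ik; apply/eqP => e; have := first _ ik; rewrite stepS e hphiE /a hM.1.
  by rewrite porbit_stable.
have phi1E i : i < k -> phi1 (step M i) = step M i.+1.
  move=> ik; rewrite permM s1E ?stepS ?hphiE //.
    apply/eqP => e; have : step M i = step M k by rewrite -[LHS]hM.1 e -[RHS]hM.1.
    by apply: step_neq ik _; apply: ltnW.
  by apply: contra (na i ik) => /eqP e; rewrite -[step M i]hM.1 e.
(* The walk is off the root vertex from time 1 to [k], so the cut does not alter it, and [b] remains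
   connected to [z] through the mate of [z]. *)
have kphi1 : step M k \in porbit phi1 b.
  suff h i : i <= k -> step M i \in porbit phi1 b by apply: h.
  elim: i => [|i IHi] ik; first by rewrite s0 porbit_id.
  by rewrite -phi1E // porbit_stable // IHi // ltnW.
have sp1 : spanning s1 (ha M) [set r].
  move=> S sS aS; rewrite sub1set => rS; apply: spM; rewrite ?sub1set //.
  have bS : b \in S by rewrite -s1r sS.
  have zS : z \in S by apply/aS/(stable_porbit _ bS kphi1)/stableM.
  have -> : hs M = (tperm z b * s1)%g by rewrite mulgA tperm2 mul1g.
  by apply: stableM => //; apply: stable_tperm; rewrite bS zS.
have phi1t : phi1 = (tperm (ha M z) a * hphi M)%g.
  rewrite /phi1 /s1 /hphi !mulgA; congr (_ * _)%g.
  by rewrite -mul_tperm hM.1 /a hM.1.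
(* For [z != b] the cut adds a vertex. If [a] and the mate of [z] shared a face, a face would be
   added as well, against [euler_le]. So two faces merge, which puts [a] on the face of [b]. *)
have [aphi1 e1] : a \in porbit phi1 b /\ euler s1 (ha M) = #|dart M| + 2.
  have [zb|zb] := eqVneq z b.
    move: kphi1; rewrite -az /phi1 /s1 zb -/a tperm1 mul1g => aphi; split=> //.
  have za : ha M z != a by rewrite (inj_eq perm_inj).
  have V1 : #|porbits s1| = #|porbits (hs M)|.+1.
    by apply: porbits_split => //; rewrite -eq_porbit_mem; move: zP bP; rewrite -!eq_porbit_mem => /eqP-> /eqP->.
  have [zf|zf] := boolP (ha M z \in porbit (hphi M) a).
    have F1 := porbits_split za zf; have := euler_le sp1.
    have aux (v e f t : nat) : v + e + f = t + 2 -> v.+1 + e + f.+1 <= t + 2 -> false by clear; lia.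
    by move: eM; rewrite /euler -/phi1 phi1t F1 V1 cards1 => /aux h /h.
  have F1 := porbits_merge zf; split.
    have := porbit_tperm_merge zf; rewrite -phi1t az -eq_porbit_mem => /eqP e.
    by rewrite -eq_porbit_mem -e eq_porbit_mem.
  have aux (v e f1 f t : nat) : f1.+1 = f -> v + e + f = t -> v.+1 + e + f1 = t by clear; lia.
  by move: F1 eM; rewrite /euler -phi1t -/phi1 V1; apply: aux.
(* Deleting the edge would add one to E and one to F, two above the bound for a connected map. *)
have [S [sS aS rS ST]] : exists S, [/\ stable s1 S, stable a2 S, [set r] \subset S & S != setT].
  have [/euler_le|//] := spanning_or s1 a2 [set r].
  have E2 : #|porbits a2| = #|porbits (ha M)|.+1.
    by apply: porbits_split => //; apply: porbit_stable; apply: porbit_id.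
  have F2 : #|porbits (a2 * s1)| = #|porbits phi1|.+1.
    by rewrite -mulgA; apply: porbits_split.
  have aux (v e f t : nat) : v + e + f = t + 2 -> v + e.+1 + f.+1 <= t + 2 -> false by clear; lia.
  by move: e1; rewrite /euler F2 E2 cards1 => /aux h /h.
move: rS; rewrite sub1set => rS.
have bS : b \in S by rewrite -s1r sS.
have aM (W : {set dart M}) : stable a2 W -> a \in W -> b \in W -> stable (ha M) W.
  move=> aW aW' bW; have -> : ha M = (tperm a b * a2)%g by rewrite mulgA tperm2 mul1g.
  by apply: stableM => //; apply: stable_tperm; rewrite aW' bW.
have aNS : a \notin S.
  by apply: contra ST => aS'; apply/eqP; apply: sp1; rewrite ?sub1set //; apply: aM.
(* [s2] takes [b] out of the root vertex. [M'] will be [S] without [b], and [N] the complement of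
   [S], rooted at [a]. *)
pose s2 := (tperm r b * s1)%g.
have rb : r != b by rewrite eq_sym.
have s2r : s2 r = y by rewrite permM tpermL.
have s2b : s2 b = b by rewrite permM tpermR.
have s2E x : x != r -> x != b -> s2 x = s1 x by move=> xr xb; rewrite permM tpermD // eq_sym.
pose A := [pred x | (x \in S) && (x != b)]; pose B := [pred x | x \notin S].
have s2A x : A x -> A (s2 x).
  case/andP=> xS xb; apply/andP; split; last by rewrite -s2b (inj_eq perm_inj).
  by apply: stableM => //; apply: stable_tperm; rewrite rS bS.
have a2A x : A x -> A (a2 x).
  by case/andP=> xS xb; apply/andP; split; [apply: aS | rewrite -a2b (inj_eq perm_inj)].
have s1B x : B x -> B (s1 x) by rewrite /= stable_mem.
have a2B x : B x -> B (a2 x) by rewrite /= stable_mem.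
have rA : A r by rewrite /= rS.
have a2inv x : a2 (a2 x) = x.
  have [->|xa] := eqVneq x a; first by rewrite !a2a.
  have [->|xb] := eqVneq x b; first by rewrite !a2b.
  rewrite (a2E x) // a2E ?hM.1 //; last by apply: contra xa => /eqP e; rewrite /a -e hM.1.
  by apply: contra xb => /eqP e; rewrite -(inj_eq (@perm_inj _ (ha M))) e.
pose M' := HMap (restr s2A) (restr a2A) (exist _ r rA).
pose N := HMap (restr s1B) (restr a2B) (exist _ a aNS).
have hM' : halfrooted M'.
  split=> -[x xA]; first by apply: val_inj; rewrite !val_restr a2inv.
  rewrite -!(inj_eq val_inj) val_restr /= a2E ?hM.2 //; last by case/andP: xA.
  by apply/eqP=> e; case/negP: (aNS); rewrite -e; case/andP: xA.
have hN : halfrooted N.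
  split=> -[x xB]; first by apply: val_inj; rewrite !val_restr a2inv.
  rewrite -!(inj_eq val_inj) val_restr /=; have [->|xa] := eqVneq x a; first by rewrite a2a eqxx.
  rewrite a2E //; last by apply: contraTneq bS => <-.
  by rewrite hM.2; apply: contraTF rS => /eqP xr; rewrite /r -xr.
(* A stable part of [M'] containing the root becomes stable in the cut map once [b] and all of [N]
   are added. *)
have spM' : spanning (hs M') (ha M') [set hroot M'].
  apply: spanning_restr => W /subsetP WA sW aW rW x xA.
  have : x \in W :|: [set x | (x == b) || B x].
    rewrite (sp1 (W :|: [set x | (x == b) || B x])) ?inE // => [u||]; last by rewrite sub1set inE rW.
      rewrite !inE => /or3P[uW|/eqP->|uS]; last by rewrite (stable_mem _ sS) uS !orbT.
      - have [->|ur] := eqVneq u r; first by rewrite s1r eqxx orbT.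
        by rewrite -s2E ?sW //; case/andP: (WA u uW).
      - by rewrite s1b -s2r sW.
    apply: aM; rewrite ?inE ?eqxx ?aNS ?orbT // => u.
    by rewrite !inE => /or3P[/aW->//|/eqP->|uB]; rewrite ?a2b ?eqxx ?orbT // (stable_mem _ aS) uB !orbT.
  by move: xA => /andP[xS /negPf xb]; rewrite !inE xb xS orbF.
have spN : spanning (hs N) (ha N) [set hroot N].
  apply: spanning_restr => W /subsetP WB sW aW aW' x xB.
  have : x \in W :|: S; last by rewrite inE (negPf xB) orbF.
  rewrite (sp1 (W :|: S)) ?inE // => [u||].
  - by rewrite !inE => /orP[/sW->|/sS->]; rewrite ?orbT.
  - apply: aM; rewrite ?inE ?bS ?orbT //; last by rewrite aW'.
    by move=> u; rewrite !inE => /orP[/aW->|/aS->]; rewrite ?orbT.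
  - by rewrite sub1set inE rS orbT.
have valphi u : val (hphi N u) = s1 (a2 (val u)) by rewrite hphiE !val_restr.
have val0 : val (step N 0) = s1 a by rewrite valphi a2a.
have stepNb i : i < k -> step M i.+1 != b.
  by move=> ik; apply/eqP => e; have := first _ ik; rewrite e bP.
have stepN i : i < k -> val (step N i) = step M i.+1.
  elim: i => [|i IHi] ik.
    rewrite val0 s1E //; first by rewrite stepS s0 hphiE.
    apply/eqP => aez; have : step M 0 = step M k by rewrite s0 -az -aez /a hM.1.
    by apply: step_neq ik _; apply: ltnW.
  rewrite stepS valphi IHi ?(ltnW ik) // a2E ?na //.
    by rewrite -[RHS]phi1E // [RHS]permM.
  exact/stepNb/ltnW.
have za : z != b -> step M k != a by move=> zb; rewrite -az (inj_eq perm_inj).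
have z0 : k = 0 -> z = a by move=> k0; rewrite /z k0 s0.
have stepNk : z != b -> val (step N k) = s1 z.
  move=> zb; case: (posnP k) => [k0|kp]; first by rewrite k0 val0 z0.
  have kb : step M k != b by have := stepNb k.-1; rewrite prednK // => ->.
  by rewrite -(prednK kp) stepS valphi stepN prednK // a2E // za.
have zB : z != b -> B z.
  move=> zb; case: (posnP k) => [k0|kp]; first by rewrite z0.
  have kb : step M k != b by have := stepNb k.-1; rewrite prednK // => ->.
  rewrite /z -a2E ?za //; apply/(a2B).
  by have := stepN k.-1; rewrite prednK // => <- //; apply: (valP (step N k.-1)).
have first' : z != b -> forall i, i < k -> step N i \notin porbit (hs N) (step N k).
  move=> zb i ik; apply: contra (first _ ik).
  rewrite -(@mem_imset_porbit _ _ _ s1 val) => [||u]; [|exact: val_inj|by rewrite val_restr].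
  rewrite stepN // stepNk // => h; apply: (stable_porbit _ _ h).
    by apply: stableM; [apply: stable_tperm; rewrite zP bP | apply: porbit_stable].
  by rewrite permM tpermL porbit_stable.
(* If [z = b], the walk of [N] closes exactly at time [k], the value reserved for a new vertex.
   Otherwise [k] is the first visit to the vertex of [z]. *)
have [adm cN] : admissible N k /\ omap val (corner N k) = if z == b then None else Some z.
  have [zb|zb] := boolP (z == b).
    move/eqP in zb.
    have kp : 0 < k by rewrite lt0n; apply: contraNneq ab => /z0 <-; apply/eqP.
    have kr : step N k.-1 = hroot N.
      by apply: val_inj; rewrite stepN prednK //= -az zb.
    suff -> : k = size (walk N) by split; [split; rewrite ?ltnn | rewrite /corner ltnn].
    have d0 := size_walk_gt0 N; case: (ltngtP k (size (walk N))) => // lt.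
      case: (@step_neq N k.-1 (size (walk N)).-1); rewrite ?prednK // ?kr ?step_last //.
      by rewrite -ltnS !prednK.
    have lt1 : (size (walk N)).-1 < k.-1 by rewrite -ltnS !prednK.
    have := na (size (walk N)).-1.+1; rewrite -stepN prednK // ?step_last ?eqxx.
      by move=> /(_ lt).
    by apply: ltnW.
  (* Were the walk not longer than [k], the dart at time [k] would have occurred one period earlier,
     against [first']. *)
  have kdN : k < size (walk N).
    rewrite ltnNge; apply/negP => dk; have := first' zb (k - size (walk N)).
    rewrite -(step_periodic N (_ - _)) subnK // porbit_id.
    by rewrite ltn_subrL size_walk_gt0 (leq_trans (size_walk_gt0 N) dk) => /(_ isT).
  split; first by split=> [|_]; [apply: ltnW | apply: first'].
  rewrite /corner kdN /=; congr Some.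
  have -> : step N k = hs N (exist _ z (zB zb)).
    by apply: val_inj; rewrite val_restr; apply: stepNk.
  by rewrite permK.
pose f (u : dart (glue M' (corner N k))) : dart M :=
  match u with None => b | Some (inl x) => val x | Some (inr x) => val x end.
have fI : injective f.
  have AB (x : dart M') (x' : dart N) : val x <> val x'.
    by move=> e; have := valP x'; rewrite -e /=; have /andP[->] := valP x.
  have Ab (x : dart M') : val x <> b by move=> e; have /andP[_] := valP x; rewrite e eqxx.
  have Bb (x : dart N) : val x <> b by move=> e; have := valP x; rewrite /= e bS.
  case=> [[x|x]|] [[x'|x']|] //=.
  - by move/val_inj->.
  - by move/AB.
  - by move/Ab.
  - by move/esym/AB.
  - by move/val_inj->.
  - by move/Bb.
  - by move/esym/Ab.
  - by move/esym/Bb.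
have fF x : f (glueL N x) = val x by [].
have fG x : f (glueR M' x) = val x by [].
have fN : f None = b by [].
have Az x : A x -> x != z.
  case/andP=> xS xb; apply/eqP => xz; move: xS xb; rewrite xz => zS /zB.
  by rewrite /= zS.
have Aa x : A x -> x != a by case/andP=> xS _; apply/eqP => e; case/negP: (aNS); rewrite -e.
have Bb x : B x -> x != b by move=> xB; apply/eqP => e; move: xB; rewrite e /= bS.
have zF : hs M z = f (glueL N (hs M' (hroot M'))) by rewrite zy fF val_restr.
have fm : morph f.
  split=> //.
  - case=> [[x|x]|]; rewrite -?/(glueL N x) -?/(glueR M' x).
    + rewrite fF; have [->|xr] := eqVneq x (hroot M'); first by rewrite glue_s_root.
      have /andP[_ xb] := valP x.
      by rewrite glue_s_F // fF val_restr s2E ?s1E ?Az ?(valP x).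
    + rewrite glue_s_G fG; move: cN; case: (corner N k) => [w|]; last first.
        case: eqP => // zb _; rewrite fG val_restr s1E ?Bb ?(valP x) //.
        by apply: contraNneq (Bb _ (valP x)) => ->; apply/eqP.
      case: eqP => // /eqP zb [wz].
      have -> : (Some w == Some x) = (val x == z).
        by rewrite -[z]wz (inj_eq val_inj) (inj_eq (@Some_inj _)) eq_sym.
      by case: eqP => [->|/eqP xz]; rewrite ?zF // fG val_restr s1E ?Bb ?(valP x).
    + rewrite glue_s_None fN; move: cN; case: (corner N k) => [w|]; case: eqP => // zb.
        by case=> wz; have {}wz : val w = z := wz; rewrite fG val_restr wz.
      by rewrite -zF zb.
  - case=> [[x|x]|]; rewrite -?/(glueL N x) -?/(glueR M' x).
    + have /andP[_ xb] := valP x.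
      by rewrite glue_a_F !fF val_restr a2E ?Aa ?(valP x).
    + have [->|xr] := eqVneq x (hroot N); first by rewrite glue_a_root fN fG /= /a hM.1.
      by rewrite glue_a_G // !fG val_restr a2E ?Bb ?(valP x) // -[a]/(val (hroot N)) (inj_eq val_inj).
    + by rewrite glue_a_None fN fG val_restr a2a.
have i : iso M (glue M' (corner N k)).
  by apply: iso_sym; exists f => //; apply: inj_morph_bij.
have eG := glue_euler hM' hN (corner_face N k).
(* Each sum obeys its Euler bound, and together they reach the sum of the bounds, so both are
   equalities. *)
have [eM' eN] : euler (hs M') (ha M') = #|dart M'| + 2 /\ euler (hs N) (ha N) = #|dart N| + 2.
  have := euler_le spM'; have := euler_le spN; rewrite !cards1.
  have aux (m n p q : nat) : ((m + n).+1 + 2).+1 = p + q -> q <= n + 2 -> p <= m + 2 ->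
      p = m + 2 /\ q = n + 2 by clear; lia.
  by move: eG; rewrite -(iso_euler i) eM (iso_card i) /= card_option card_sum; apply: aux.
by exists M', N, k.
Qed.

(** * V-trees *)

Definition attach M N l := glue M (corner N (visit N l)).

Lemma card_attach M N l : #|dart (attach M N l)| = (#|dart M| + #|dart N|).+1.
Proof. by rewrite card_option card_sum. Qed.

Lemma card_attach_gt1 M N l : 1 < #|dart (attach M N l)|.
Proof.
by rewrite card_attach ltnS (leq_trans _ (leq_addr _ _)) //; apply/card_gt0P; exists (hroot M).
Qed.

Lemma attach_outer M N l : valid M -> valid N -> l <= outer N ->
  outer (attach M N l) = outer M + l.
Proof.
move=> [hM _ _] [hN _ _] lN; rewrite glue_outer ?seen_visit //; exact: visit_admissible.
Qed.

Lemma attach_valid M N l : valid M -> valid N -> valid (attach M N l).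
Proof.
move=> [hM spM eM] [hN spN eN]; split; [exact: glue_halfrooted|exact: glue_spanning|].
have := glue_euler hM hN (corner_face N (visit N l)).
by rewrite eM eN -/(attach M N l) card_attach; lia.
Qed.

Definition trivial_map := @HMap unit 1 1 tt.

Lemma trivial_map_valid : valid trivial_map.
Proof.
split=> [||/=]; first by split=> -[]; rewrite !perm1.
  by move=> S _ _; rewrite sub1set => rS; apply/setP => -[]; rewrite inE.
by rewrite /euler mul1g !porbits1 card_unit.
Qed.

Lemma trivial_map_outer : outer trivial_map = 1.
Proof.
rewrite outerE; apply/eqP; rewrite eqn_leq; apply/andP; split.
  by apply: leq_trans (leq_imset_card _ _) _; rewrite -[X in _ <= X]card_unit max_card.
by rewrite card_gt0; apply/set0Pn; exists (porbit (hs trivial_map) tt); rewrite imset_f ?porbit_id.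
Qed.

(** The label of a node acts at its parent, where it selects the place of attachment. *)
Fixpoint map_of (t : vtree) : hmap :=
  let: VNode _ cs := t in
  foldr (fun c M => attach M (map_of c) `|vlabel c|%N) trivial_map cs.

Lemma vtree_ind_cons (P : vtree -> Prop) :
  (forall l, P (VNode l [::])) ->
  (forall l c cs, P c -> P (VNode l cs) -> P (VNode l (c :: cs))) -> forall t, P t.
Proof.
move=> P0 P1; fix IH 1 => -[l]; elim=> [|c cs IHcs]; first exact: P0.
by apply: P1.
Qed.

Lemma child_sum_cons c cs : child_sum (c :: cs) = (vlabel c + child_sum cs)%R.
Proof. by rewrite /child_sum big_cons. Qed.

Lemma vt_ok_label c : vt_ok false c ->
  [/\ (0 <= vlabel c)%R, (vlabel c <= 1 + child_sum (vchildren c))%R & all (vt_ok false) (vchildren c)].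
Proof. by case: c => l cs /= /and3P[_ /andP[]]. Qed.

(** The trivial map has one outer vertex and each child adds its label: this is the origin of
    [1 + child_sum], both as the root label and as the bound on the other labels. *)
Lemma map_ofP t : all (vt_ok false) (vchildren t) ->
  [/\ valid (map_of t), Posz (outer (map_of t)) = (1 + child_sum (vchildren t))%R
    & #|dart (map_of t)| = (2 * vsize t).+1].
Proof.
elim/vtree_ind_cons: t => [l _|l c cs IHc IHcs].
  by rewrite /child_sum big_nil /= trivial_map_outer card_unit; split => //; apply: trivial_map_valid.
rewrite [vchildren _]/=; case/andP=> /vt_ok_label[l0 l1 /IHc[vc oc sc]] /IHcs[vcs ocs scs].
have lc : `|vlabel c|%N <= outer (map_of c) by move: l0 l1; rewrite -oc; lia.
split; first exact: attach_valid.
  rewrite [map_of _]/= attach_outer // child_sum_cons.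
  by move: ocs; rewrite [vchildren _]/= [map_of _]/= => ocs; rewrite PoszD ocs; lia.
rewrite [map_of _]/= card_attach; move: scs; rewrite [map_of _]/= => ->.
by rewrite sc /=; lia.
Qed.

Lemma map_of_surj M : valid M -> exists t, is_vtree t /\ iso M (map_of t).
Proof.
have [k] := ubnP #|dart M|; elim: k M => // k IHk M lek vM.
have [T1|T1] := leqP #|dart M| 1.
  exists (VNode 1 [::]); split; first by rewrite /is_vtree /= /child_sum big_nil.
  have eqT (x y : dart M) : x = y by exact: (fintype_le1P T1).
  exists (fun=> tt : dart trivial_map); last by split=> // x; rewrite perm1.
  by exists (fun=> hroot M) => [x|[]].
have [M' [N [j [vM' vN adm i]]]] := decompose vM T1.
have := iso_card i; rewrite card_option card_sum => cM.
have [[l cs] [ok iM]] : exists t, is_vtree t /\ iso M' (map_of t) by apply: IHk => //; lia.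
have [[l' cs'] [ok' iN]] : exists t, is_vtree t /\ iso N (map_of t) by apply: IHk => //; lia.
have [okcs okcs'] : all (vt_ok false) cs /\ all (vt_ok false) cs'.
  by move: ok ok'; rewrite /is_vtree /= => /and3P[_ _ ->] /and3P[_ _ ->].
(* The tree found for [N] keeps its children, and its root label is replaced by the attachment
   label. *)
pose c := VNode (Posz (seen N j)) cs'.
have [_ oc _] := @map_ofP c okcs'.
have cE : map_of c = map_of (VNode l' cs') by [].
have lc : (Posz (seen N j) <= 1 + child_sum cs')%R.
  by rewrite -[child_sum _]/(child_sum (vchildren c)) -oc cE -(iso_outer iN); apply: seen_le.
exists (VNode (1 + child_sum (c :: cs))%R (c :: cs)); split.
  rewrite /is_vtree /= eqxx okcs okcs' lc /= !andbT.
  case: (cs') lc => //=; rewrite /child_sum big_nil; lia.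
apply: (iso_trans i); rewrite [map_of _]/= -/(map_of c).
have jE : j = visit (map_of c) (seen N j).
  by rewrite -[LHS](visit_seen adm); apply: iso_visit iN.
case: iM iN => p pB pm [q qB qm]; rewrite /attach -jE (iso_corner _ qB qm).
exact: (glue_iso (corner N j) pB pm qB qm).
Qed.

(** Equal attachment times give equal child labels by [seen_visit]; the root label of a v-tree
    follows from the children. *)
Lemma map_of_inj t t2 : all (vt_ok false) (vchildren t) -> all (vt_ok false) (vchildren t2) ->
  iso (map_of t) (map_of t2) -> vchildren t = vchildren t2.
Proof.
elim/vtree_ind_cons: t t2 => [l|l c cs IHc IHcs] [l2 [|c2 cs2]] //; rewrite [vchildren _]/= [vchildren (VNode l2 _)]/=.
- move=> _ _ /iso_card; rewrite [map_of _]/= [map_of (VNode l2 _)]/= card_unit.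
  by have := card_attach_gt1 (map_of (VNode l2 cs2)) (map_of c2) `|vlabel c2|%N => /[swap] <-.
- move=> _ _ /iso_card; rewrite [map_of _]/= [map_of (VNode l2 _)]/= card_unit.
  by have := card_attach_gt1 (map_of (VNode l cs)) (map_of c) `|vlabel c|%N => /[swap] ->.
case/andP=> okc okcs /andP[okc2 okcs2].
have [l0 l1 okcc] := vt_ok_label okc; have [l20 l21 okcc2] := vt_ok_label okc2.
have [[hN spN _] oN _] := map_ofP okcc; have [[hN2 spN2 _] oN2 _] := map_ofP okcc2.
have [[hM spM _] _ _] := @map_ofP (VNode l cs) okcs.
have [[hM2 spM2 _] _ _] := @map_ofP (VNode l2 cs2) okcs2.
case/(glue_inj hM hN hM2 hN2 spM spN spM2 spN2 (visit_admissible _ _) (visit_admissible _ _)) => iM iN jE.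
have -> : cs = cs2 := IHcs (VNode l2 cs2) okcs okcs2 iM.
have ch := IHc _ okcc okcc2 iN; congr cons.
have le1 : `|vlabel c|%N <= outer (map_of c) by clear -l0 l1 oN; lia.
have le2 : `|vlabel c2|%N <= outer (map_of c) by rewrite (iso_outer iN); clear -l20 l21 oN2; lia.
have lE : vlabel c = vlabel c2.
  rewrite -(iso_visit _ iN) in jE.
  have := congr1 (seen (map_of c)) jE; rewrite !seen_visit //; clear -l0 l20; lia.
by case: (c) (c2) ch lE => [m d] [m2 d2] /= -> ->.
Qed.

(** * Maps without the root half-edge *)

(** [None] is inserted just before [r] in its cycle, or stays a fixed point when there is no
    root. *)
Definition insert_root (A : finType) (s : {perm A}) (r : option A) : {perm option A} :=
  (lift_opt s * tperm None r)%g.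

Definition half_map n (M : rmap n) :=
  HMap (insert_root (msigma M) (mroot M)) (lift_opt (malpha M)) None.

Lemma insert_root_None (A : finType) (s : {perm A}) r : insert_root s r None = r.
Proof. by rewrite permM lift_optE tpermL. Qed.

Lemma insert_root_Some (A : finType) (s : {perm A}) r x :
  insert_root s r (Some x) = if Some (s x) == r then None else Some (s x).
Proof.
rewrite permM lift_optE /=; case: eqP => [->|/eqP h]; first by rewrite tpermR.
by rewrite tpermD // eq_sym.
Qed.

(** The edge involution fixes the half-edge, so the face permutation changes by the same insertion
    as the vertex rotation. *)
Lemma half_map_phi n (M : rmap n) : hphi (half_map M) = insert_root (mphi M) (mroot M).
Proof. by rewrite /hphi /= /insert_root mulgA lift_optM. Qed.

Lemma porbits_insert_root (A : finType) (s : {perm A}) r :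
  #|porbits (insert_root s (Some r))| = #|porbits s|.
Proof.
pose u := (s^-1 r)%g.
have e : insert_root s (Some r) = (tperm None (Some u) * lift_opt s)%g.
  by rewrite -mul_tperm !lift_optE /= permKV.
apply: succn_inj; rewrite e -(porbits_lift_opt s) porbits_merge //.
apply/negP => /(porbit_invariant (f := isSome)) h.
by suff : false = true by []; apply: h => -[v|]; rewrite lift_optE.
Qed.

Lemma insert_root_class (A : finType) (s : {perm A}) r u v :
  (porbit (insert_root s (Some r)) u = porbit (insert_root s (Some r)) v) <->
  (porbit s (odflt r u) = porbit s (odflt r v)).
Proof.
set t := insert_root _ _.
have inv w : porbit s (odflt r (t w)) = porbit s (odflt r w).
  case: w => [x|]; last by rewrite insert_root_None.
  rewrite insert_root_Some; case: eqP => [[<-]|_] /=; exact: porbit_perm1.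
have step x : porbit t (Some (s x)) = porbit t (Some x).
  rewrite -[RHS]porbit_perm1 insert_root_Some; case: eqP => // ->.
  by rewrite -[RHS]porbit_perm1 insert_root_None.
have dflt w : porbit t (Some (odflt r w)) = porbit t w.
  by case: w => // /=; rewrite -[RHS]porbit_perm1 insert_root_None.
split=> /eqP; rewrite eq_porbit_mem => h.
  exact: (porbit_invariant (f := fun w => porbit s (odflt r w)) inv h).
rewrite -dflt -[RHS]dflt.
exact: (porbit_invariant (f := fun x => porbit t (Some x)) step h).
Qed.

Lemma half_map_outer n (M : rmap n) : (mroot M == None) = (n == 0) ->
  outer (half_map M) = outv M.
Proof.
move=> rn; rewrite outerE half_map_phi /outv /=; case: (mroot M) rn => [r|] rn.
  set W := porbit _ _; set s := msigma M; set K := porbit _.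
  have -> : #|K @: W| = #|(fun u => porbit s (odflt r u)) @: W|.
    by apply/eqP; rewrite eqn_leq; apply/andP; split; apply: leq_card_imset => u v /insert_root_class.
  suff -> : (fun u => porbit s (odflt r u)) @: W =
      [set v in mvertices M | ~~ [disjoint v & porbit (mphi M) r]] by [].
  have WE u : (u \in W) = (odflt r u \in porbit (mphi M) r).
    rewrite /W -!eq_porbit_mem; apply/eqP/eqP; last by move=> h; apply/insert_root_class.
    by move/insert_root_class.
  apply/setP => S; rewrite inE; apply/imsetP/andP => [[u uW ->]|[/imsetP[x _ ->]]].
    split; first by apply: imset_f; rewrite inE.
    by apply/pred0Pn; exists (odflt r u); rewrite /= porbit_id -WE.
  case/pred0Pn => y /= /andP[xy yr]; exists (Some y); first by rewrite WE.
  by apply/eqP; rewrite eq_sym eq_porbit_mem.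
have n0 : n = 0 by apply/eqP; rewrite -rn.
apply/eqP; rewrite eqn_leq; apply/andP; split.
  apply: leq_trans (leq_imset_card _ _) _; apply: leq_trans (max_card _) _.
  by rewrite card_option card_ord n0.
by rewrite card_gt0; apply/set0Pn; eexists; apply: imset_f; apply: porbit_id.
Qed.

Lemma card_involution_porbits (A : finType) (s : {perm A}) :
  (forall x, s x != x /\ s (s x) = x) -> #|A| = #|porbits s| * 2.
Proof.
move=> hs; have E : porbits s = [set orbit 'P <[s]> x | x in setT].
  by rewrite /porbits porbitE; apply/setP=> S; apply/imsetP/imsetP => -[x _ ->]; exists x.
rewrite -cardsT E; apply: card_uniform_partition; last first.
  by apply: orbit_partition; apply/actsP => a _ x; rewrite !inE.
move=> _ /imsetP[x _ ->]; rewrite -porbitE.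
suff -> : porbit s x = [set x; s x] by rewrite cards2 eq_sym (hs x).1.
apply/eqP; rewrite eqEsubset; apply/andP; split; last first.
  by apply/subsetP => y /set2P[->|->]; rewrite ?porbit_id // porbit_stable ?porbit_id.
apply/subsetP => y; apply: stable_porbit; last exact: set21.
by move=> z /set2P[->|->]; rewrite ?(hs _).2 !inE eqxx ?orbT.
Qed.

Lemma half_map_halfrooted n (M : rmap n) : halfrooted (half_map M) <->
  forall d, malpha M d != d /\ malpha M (malpha M d) = d.
Proof.
split=> [[h1 h2] d|h].
  have := h1 (Some d); have := h2 (Some d); rewrite /= !lift_optE /=.
  by rewrite (inj_eq (@Some_inj _)) => -> [->].
split=> -[d|]; rewrite /= ?lift_optE //= ?lift_optE /= ?(h d).2 //.
by rewrite (inj_eq (@Some_inj _)); apply/negbTE; case: (h d).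
Qed.

(** There are 2n + 1 darts and n + 1 orbits of [ha], so V + (n + 1) + F = (2n + 1) + 2 amounts to V
    + F = n + 2. For n = 0 all three counts are 1. *)
Lemma half_map_euler n (M : rmap n) : halfrooted (half_map M) ->
  (mroot M == None) = (n == 0) ->
  (euler (hs (half_map M)) (ha (half_map M)) = #|dart (half_map M)| + 2 <->
   n = 0 \/ #|mvertices M| + #|mfaces M| = n + 2).
Proof.
move=> /half_map_halfrooted h rn.
have := card_involution_porbits h; rewrite card_ord => E.
rewrite /euler -[(_ * _)%g]/(hphi (half_map M)) half_map_phi /= card_option card_ord porbits_lift_opt.
case: (mroot M) rn => [r|] rn.
  rewrite !porbits_insert_root -/(mvertices M) -/(mfaces M).
  move: (#|mvertices M|) (#|mfaces M|) (#|porbits (malpha M)|) E => v f e E.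
  have n0 : n != 0 by rewrite -rn.
  by clear -n0 E; lia.
have n0 : n = 0 by apply/eqP; rewrite -rn.
rewrite /insert_root tperm1 mulg1 mulg1 !porbits_lift_opt.
have P0 (s : {perm 'I_(2 * n)}) : #|porbits s| = 0.
  apply/eqP; rewrite -leqn0; apply: leq_trans (leq_imset_card _ _) _.
  by apply: leq_trans (max_card _) _; rewrite card_ord n0.
by rewrite !P0 n0; split; [left|].
Qed.

Lemma half_map_spanning n (M : rmap n) : (mroot M == None) = (n == 0) ->
  (spanning (hs (half_map M)) (ha (half_map M)) [set hroot (half_map M)] <->
   forall d e, connect (fun x y => (y == msigma M x) || (y == malpha M x)) d e).
Proof.
move=> rn; set R := fun x y => _; split=> [sp d e|conn].
  have [C CE] : exists C : {set 'I_(2 * n)}, forall x, (x \in C) = connect R d x.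
    by exists [set x | connect R d x] => x; rewrite inE.
  have sC x : x \in C -> msigma M x \in C.
    by rewrite !CE => h; apply: connect_trans h (connect1 _); rewrite /R eqxx.
  have aC x : x \in C -> malpha M x \in C.
    by rewrite !CE => h; apply: connect_trans h (connect1 _); rewrite /R eqxx orbT.
  case er: (mroot M) rn => [r|] rn; last first.
    by have := ltn_ord d; move/esym/eqP: rn => n0; rewrite [X in _ < 2 * X]n0.
  pose S := [set u | odflt r u \in C].
  have sS : stable (hs (half_map M)) S.
    case=> [x|]; rewrite !inE /= er ?insert_root_None // insert_root_Some => xC.
    by case: eqP => [[<-]|_]; apply: sC.
  have aS : stable (ha (half_map M)) S.
    by case=> [x|]; rewrite !inE /= lift_optE //= => xC; apply: aC.
  have dS : Some d \in S by rewrite inE CE connect0.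
  (* If the component of [d] misses the root, its complement is stable and contains the root, hence
     is everything, yet it misses [d]. *)
  have [rS|rS] := boolP (None \in S).
    have /setP/(_ (Some e)) : S = setT by apply: sp; rewrite ?sub1set.
    by rewrite !inE CE.
  have /setP/(_ (Some d)) : ~: S = setT.
    by apply: sp; [exact: stableC|exact: stableC|rewrite sub1set in_setC].
  by rewrite in_setC dS inE.
move=> S sS aS; rewrite sub1set => rS.
case er: (mroot M) rn => [r|] rn; last first.
  apply/setP => -[x|]; rewrite inE //.
  by have := ltn_ord x; move/esym/eqP: rn => n0; rewrite [X in _ < 2 * X]n0.
have rS' : Some r \in S by have := sS _ rS; rewrite /= er insert_root_None.
pose C := [set x | Some x \in S].
have sC : stable (msigma M) C.
  move=> x; rewrite !inE => /sS; rewrite /= er insert_root_Some.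
  by case: eqP => [->|].
have aC : stable (malpha M) C by move=> x; rewrite !inE => /aS; rewrite /= lift_optE.
have closedC : closed R (mem C).
  by move=> x y /orP[] /eqP ->; rewrite /= (stable_mem _ sC, stable_mem _ aC).
apply/setP => -[x|]; rewrite inE //.
by have := closed_connect closedC (conn r x); rewrite /= !inE rS' => <-.
Qed.

Lemma is_rmapP n (M : rmap n) : (mroot M == None) = (n == 0) ->
  (is_rmap M <-> valid (half_map M)).
Proof.
move=> rn; split.
  case=> /half_map_halfrooted h /(half_map_spanning rn) sp /(half_map_euler h rn) e _.
  by split.
case=> h /(half_map_spanning rn) sp /(half_map_euler h rn) e.
by split=> //; apply/half_map_halfrooted.
Qed.

Lemma half_map_iso n (M M' : rmap n) : rmap_iso M M' <-> iso (half_map M) (half_map M').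
Proof.
split=> [[p [ps pa pr]]|[q qB [qs qa qr]]].
  exists (omap p : dart (half_map M) -> dart (half_map M')).
    exists (omap (p^-1)%g) => -[x|] //=; by rewrite ?permK ?permKV.
  split=> //= u.
    rewrite /insert_root !permM (inj_tperm _ _ _ (@inj_omap _ _ p perm_inj)) pr !lift_optE.
    by case: u => //= x; rewrite ps.
  by rewrite !lift_optE; case: u => //= x; rewrite pa.
have qI := bij_inj qB; rewrite /= in qs qa qr.
have qS x : exists y, q (Some x) = Some y.
  case e: (q (Some x)) => [y|]; first by exists y.
  by have := qI _ _ (etrans e (esym qr)).
pose p x := odflt x (q (Some x)).
have pE x : q (Some x) = Some (p x) by rewrite /p; case: (qS x) => y ->.
have pI : injective p by move=> x y e; have := pE x; rewrite e -pE => /qI [].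
exists (perm pI).
have rE : q (mroot M) = mroot M'.
  by rewrite -[mroot M](insert_root_None (msigma M)) qs qr insert_root_None.
have lE (s : {perm 'I_(2 * n)}) d : lift_opt s (Some d) = Some (s d) by rewrite lift_optE.
split=> [d|d|].
- rewrite !permE; apply: Some_inj; rewrite -[LHS]pE -[RHS]lE -pE -lE.
  have := qs (Some d); rewrite /insert_root !permM (inj_tperm _ _ _ qI) rE qr.
  exact: perm_inj.
- by rewrite !permE; apply: Some_inj; rewrite -[LHS]pE -[RHS]lE -pE -lE qa.
- by rewrite -rE; case: (mroot M) => [x|] /=; rewrite ?qr // permE pE.
Qed.

Lemma transport_hmap (H : hmap) (U : finType) (e : dart H -> U) : bijective e ->
  exists s a, iso H (HMap s a (e (hroot H))).
Proof.
case=> e' eK e'K.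
have conjI (s : {perm dart H}) : injective (fun u => e (s (e' u))).
  by move=> u v /(can_inj eK)/perm_inj/(can_inj e'K).
exists (perm (conjI (hs H))), (perm (conjI (ha H))), e; first by exists e'.
by split=> // x; rewrite permE /= eK.
Qed.

Lemma lift_opt_surj (A : finType) (s : {perm option A}) : s None = None ->
  exists t, s = lift_opt t.
Proof.
move=> sN; pose t x := odflt x (s (Some x)).
have tE x : s (Some x) = Some (t x).
  rewrite /t; case e: (s (Some x)) => [y|] //.
  by have := perm_inj (etrans e (esym sN)).
have tI : injective t by move=> x y e; have := tE x; rewrite e -tE => /perm_inj [].
by exists (perm tI); apply/permP => -[x|]; rewrite lift_optE /= ?permE.
Qed.

Lemma half_map_surj n (H : hmap) : valid H -> #|dart H| = (2 * n).+1 ->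
  exists M : rmap n, is_rmap M /\ iso H (half_map M).
Proof.
move=> vH cH.
have cD : #|{: {x : dart H | x != hroot H}}| = 2 * n.
  rewrite card_sig -[RHS]/(2 * n).+1.-1 -cH -(cardC1 (hroot H)).
  by apply: eq_card.
pose e x : option 'I_(2 * n) := omap (fun u => cast_ord cD (enum_rank u)) (insub x).
have eI : injective e.
  move=> x y; rewrite /e; case: insubP => [u _ <-|]; case: insubP => [v _ <-|] //=.
    by move=> /Some_inj /cast_ord_inj /enum_rank_inj ->.
  by rewrite !negbK => /eqP-> /eqP->.
have eB : bijective e by apply: inj_card_bij; rewrite // card_option card_ord cH.
have er : e (hroot H) = None by rewrite /e insubF ?eqxx.
have [s [a i]] := transport_hmap eB; rewrite er in i.
have v0 := iso_valid i vH; have [h0 sp0 _] := v0.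
have [a0 aE] := lift_opt_surj (hroot_fixed h0).
have /lift_opt_surj[s0 sE] : (s * tperm None (s None))%g None = None by rewrite permM tpermR.
pose M := @RMap n s0 a0 (s None).
have ME : HMap s a None = half_map M.
  by rewrite /half_map /= /insert_root -sE -mulgA tperm2 mulg1 -aE.
exists M; rewrite -ME; split => //; apply/is_rmapP; last by rewrite -ME.
(* If [s None = None], the root half-edge alone is stable, so it is the only dart and n = 0. *)
rewrite /=; apply/eqP/eqP => [sN|n0].
  have sT : [set None : option 'I_(2 * n)] = setT.
    apply: sp0 => [u|u|]; rewrite ?subxx // inE => /eqP->; rewrite ?(hroot_fixed h0) ?inE //.
    by rewrite /= sN.
  by have := iso_card i; rewrite cH /= -cardsT -sT cards1; clear; lia.
by case: (s None) => // x; have := ltn_ord x; rewrite [X in _ < 2 * X]n0.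
Qed.

Theorem theorem4 (n : nat) :
  exists rho : rmap n -> vtree,
    [/\ forall M : rmap n, is_rmap M ->
          [/\ is_vtree (rho M), vsize (rho M) = n & vlabel (rho M) = Posz (outv M)],
        forall M M' : rmap n, is_rmap M -> is_rmap M' ->
          (rho M = rho M' <-> rmap_iso M M')
      & forall T : vtree, is_vtree T -> vsize T = n ->
          exists M : rmap n, is_rmap M /\ rho M = T].
Proof.
(* [rho] picks a tree whose map is isomorphic to the given one. By [code_inj] there is only one, so
   isomorphic maps receive the same tree. *)
pose code (M : rmap n) t := is_vtree t /\ iso (half_map M) (map_of t).
pose rho M := epsilon (inhabits (VNode 0 [::])) (code M).
have root_ok t : is_vtree t ->
    vlabel t = (1 + child_sum (vchildren t))%R /\ all (vt_ok false) (vchildren t).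
  by case: t => l cs; rewrite /is_vtree /= => /and3P[_ /eqP].
have valid_half M : is_rmap M -> valid (half_map M).
  by move=> hM; apply/is_rmapP => //; case: hM.
have code_rho M : is_rmap M -> code M (rho M).
  by move=> /valid_half/map_of_surj; apply: epsilon_spec.
have code_inj M t t' : code M t -> code M t' -> t = t'.
  move=> [okt it] [okt' it']; have i := iso_trans (iso_sym it) it'.
  have [lt cs] := root_ok _ okt; have [lt' cs'] := root_ok _ okt'.
  have := map_of_inj cs cs' i; move: lt lt'.
  by case: (t) (t') => [l c] [l' c'] /= -> -> ->.
exists rho; split=> [M hM|M M' hM hM'|T okT sT].
- have [okt i] := code_rho _ hM; have [lE csE] := root_ok _ okt.
  have [_ oE cE] := map_ofP csE; split=> //.
    by have := iso_card i; rewrite cE card_option card_ord => -[]; lia.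
  by rewrite lE -oE -(iso_outer i) half_map_outer //; case: hM.
- have [okt i] := code_rho _ hM; have [okt' i'] := code_rho _ hM'.
  split=> [e|/half_map_iso j].
    by apply/half_map_iso/(iso_trans i); rewrite e; apply: iso_sym.
  apply: (@code_inj M) => //; split=> //; exact: iso_trans j i'.
- have [lE csE] := root_ok _ okT; have [vT _ cT] := map_ofP csE.
  have [M [hM i]] : exists M : rmap n, is_rmap M /\ iso (map_of T) (half_map M).
    by apply: half_map_surj; rewrite // cT sT.
  exists M; split=> //; apply: (@code_inj M); first exact: code_rho.
  by split=> //; apply: iso_sym.
Qed.
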